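(* Let $\Sigma$ be a $d\times d$ positive-definite matrix with $(2\pi)^{d/2}\sqrt{\det\Sigma}=1$, and let $X$ be the Gaussian DPP on $\mathbb{R}^d$ with scattering matrix $\Sigma$. For $R>0$ let $N$ be the (random) number of points of $X$ lying in the closed Euclidean ball $B(R)$ of radius $R$ centred at the origin, and let $n=\mathbb{E}[N]$. Then $$n=|B(R)|=|B(1)|R^d,$$ where $|B(t)|$ denotes the Lebesgue volume of the Euclidean ball of radius $t$, and for every $\varepsilon>0$, $$\mathbb{P}\Big[\Big|\frac{N}{n}-1\Big|\ge\varepsilon\Big]\le 2\exp\Big(-\frac{3\varepsilon^2}{6+2\varepsilon}|B(R)|\Big).$$
   Context: The Gaussian DPP with scattering matrix $\Sigma$ (a $d\times d$ positive-definite matrix) is the stationary determinantal point process on $\mathbb{R}^d$ with background measure Lebesgue measure and kernel $K(x,y)=\frac{1}{(2\pi)^{d/2}\sqrt{\det\Sigma}}\exp(-\frac12(x-y)^\top\Sigma^{-1}(x-y))$; i.e. its $k$-point correlation functions are $\rho_k(x_1,\dots,x_k)=\det[K(x_i,x_j)]_{i,j=1}^k$. Under the normalization $(2\pi)^{d/2}\sqrt{\det\Sigma}=1$ the kernel is $K(x,y)=\exp(-\frac12(x-y)^\top\Sigma^{-1}(x-y))$ and the mean density of points is $1$. *)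

(* Defs.v *)
From HB Require Import structures.
From mathcomp Require Import all_boot all_order all_algebra.
From mathcomp Require Import all_classical all_reals all_analysis measurable_realfun.
Set Implicit Arguments. Unset Strict Implicit. Unset Printing Implicit Defensive.
Import Order.TTheory GRing.Theory Num.Theory.
Local Open Scope classical_set_scope.
Local Open Scope ring_scope.

Section GaussDPP.
Variable R : realType.
Variable d : nat.

(* Points of R^d are d-tuples of reals (measurable with the product sigma-algebra
   generated by the coordinates, i.e. the Borel sigma-algebra of R^d). *)
Notation pt := (d.-tuple R).

Definition origin : pt := [tuple (0 : R) | _ < d].

Definition rowv (x : pt) : 'rV[R]_d := \row_(i < d) tnth x i.

Definition eball (r : R) : set pt :=
  [set x | \sum_(i < d) (tnth x i) ^+ 2 <= r ^+ 2].

(* Iterated Lebesgue integral over R^n of an extended-real function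
   (for nonnegative measurable f this is the integral w.r.t. Lebesgue measure
   on R^n, by Tonelli). *)
Fixpoint lebint (n : nat) : (n.-tuple R -> \bar R) -> \bar R :=
  match n return (n.-tuple R -> \bar R) -> \bar R with
  | 0 => fun f => f [tuple]
  | n'.+1 => fun f =>
      (\int[@lebesgue_measure R]_(t in [set: R])
          lebint (fun y : n'.-tuple R => f [tuple of t :: y]))%E
  end.

Definition lebvol (A : set pt) : \bar R := lebint (fun x => (\1_A x)%:E).

Fixpoint kint (k : nat) (F : seq pt -> \bar R) : \bar R :=
  match k with
  | 0 => F [::]
  | k'.+1 => lebint (fun x : pt => kint k' (fun s => F (x :: s)))
  end.

Definition gaussK (Sigma : 'M[R]_d) (x y : pt) : R :=
  expR (- (1 / 2) * ((rowv x - rowv y) *m invmx Sigma *m (rowv x - rowv y)^T) 0 0).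

Definition rho (Sigma : 'M[R]_d) (k : nat) (xs : seq pt) : R :=
  \det (\matrix_(i < k, j < k) gaussK Sigma (nth origin xs i) (nth origin xs j)).

Definition posdef (Sigma : 'M[R]_d) : Prop :=
  Sigma^T = Sigma /\ forall v : 'rV[R]_d, v != 0 -> 0 < (v *m Sigma *m v^T) 0 0.

Definition npoints (X : set pt) (A : set pt) : \bar R := counting (X `&` A).

Definition point_process (dO : measure_display) (Omega : measurableType dO)
  (X : Omega -> set pt) : Prop :=
  (forall w (r : R), finite_set (X w `&` eball r)) /\
  (forall A : set pt, measurable A ->
     measurable_fun [set: Omega] (fun w => npoints (X w) A)).

Definition gaussian_dpp (dO : measure_display) (Omega : measurableType dO)
  (P : probability Omega R) (Sigma : 'M[R]_d) (X : Omega -> set pt) : Prop :=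
  point_process X /\
  forall (k : nat) (A : nat -> set pt), (0 < k)%N ->
    (forall i, (i < k)%N -> measurable (A i)) ->
    (forall i j, (i < k)%N -> (j < k)%N -> i <> j -> A i `&` A j = set0) ->
    (\int[P]_w (\prod_(i < k) npoints (X w) (A i)))%E =
    kint k (fun xs => (\prod_(i < k) (\1_(A i) (nth origin xs i))%:E
                       * (rho Sigma k xs)%:E)%E).

End GaussDPP.

(* Main.v *)
Require Import Defs.
From HB Require Import structures.
From mathcomp Require Import all_boot all_order all_algebra finmap.
From mathcomp Require Import all_classical all_reals all_analysis measurable_realfun.
From mathcomp Require Import ring lra.
Import Order.TTheory GRing.Theory Num.Theory.
Import numFieldNormedType.Exports.
Local Open Scope ring_scope.
Set Implicit Arguments. Unset Strict Implicit. Unset Printing Implicit Defensive.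

(* Write K for the kernel and V for |B(r)|.  Cut the ball into small cells c.
   Since the correlation functions are the minors of K, the expectation of
   prod_c (1 + a N(c)) is an integral, over one uniform point x_c per cell, of
   det (1 + a diag(|c|) K(x, x)).  As the mesh tends to 0 the product tends to
   (1 + a)^N, so bounds on the determinant bound the Laplace transform of N by
   that of a Poisson variable of mean V:
   - for a >= 0, Hadamard's inequality for the positive semidefinite Gaussian
     matrices gives det K(x_1, .., x_k) <= 1, hence E (1 + a)^N <= exp(a V);
   - for a = -s with 0 <= s < 1, the matrix 1 - s K(x, x) diag(|c|) is, for a
     small mesh, an M-matrix with nonnegative row sums, because K >= 0 and the
     integral of K(x, .) is 1; its determinant is thus at most the product of
     its diagonal entries, hence E (1 - s)^N <= exp(- s V).
   Chernoff's method then yields both tails. *)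

(** * Determinants of positive semidefinite matrices and of M-matrices *)

(** The defining identity of the process only gives expectations of products of counts over pairwise
    disjoint sets, each count to the first power. The variable [(1 + a)^N] is out of its direct
    reach, while products of factors [1 + a N(c)] are multilinear in the counts; this dictates the
    cells. The classical route writes N as a sum of independent Bernoulli variables whose parameters
    are the eigenvalues of the kernel operator on the ball; finite determinants replace that
    spectral theory. For [a >= 0] each minor can be bounded separately. For [a < 0] the expansion
    has alternating signs, so the whole determinant must be bounded at once, at fixed sample points.
    There the integral of the kernel is only a Riemann sum, and the strict inequality [s < 1] leaves
    room for its error. The two limits in the mesh also differ. For [a >= 0] the products are
    nonnegative and Fatou's lemma is enough. A factor [1 - s N(c)] can be negative, so the other
    case needs dominated convergence; the dominating variable [(1 + s)^N] is integrable by the first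
    bound. *)

Definition schur (R : fieldType) (n : nat) (M : 'M[R]_n.+1) : 'M[R]_n :=
  \matrix_(i, j) (M (lift ord0 i) (lift ord0 j) -
                  M (lift ord0 i) ord0 * M ord0 (lift ord0 j) / M ord0 ord0).

Lemma det_schur (R : fieldType) (n : nat) (M : 'M[R]_n.+1) :
  M ord0 ord0 != 0 -> \det M = M ord0 ord0 * \det (schur M).
Proof.
move=> a0.
rewrite -[M in LHS](@submxK _ 1 n 1 n).
set b := ursubmx _; set c := dlsubmx _; set D := drsubmx _.
have -> : block_mx (ulsubmx (M : 'M[R]_(1 + n))) b c D =
  block_mx (M ord0 ord0)%:M 0 c 1%:M *m block_mx 1%:M ((M ord0 ord0)^-1 *: b) 0 (schur M).
  rewrite mulmx_block !mulmx1 !mul0mx !addr0 !mulmx0 !mul1mx mul_scalar_mx scalerA divff// scale1r.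
  congr block_mx; apply/matrixP=> i j; rewrite ?ord1 !mxE/=; last first.
    rewrite big_ord_recl big_ord0 !mxE addr0 !rshift1 !lshift0.
    by rewrite mulrA mulrAC addrC subrK.
  - by rewrite addr0.
  - by rewrite mulr1n; congr (M _ _); apply: val_inj.
rewrite (@det_mulmx _ (1 + n)) (@det_lblock _ 1 n) (@det_ublock _ 1 n).
by rewrite !det1 mul1r mulr1 det_scalar expr1.
Qed.

Lemma det_row0 (R : comNzRingType) (n : nat) (M : 'M[R]_n.+1) :
  (forall j, M ord0 j = 0) -> \det M = 0.
Proof.
by move=> M0; rewrite (expand_det_row _ ord0) big1// => j _; rewrite M0 mul0r.
Qed.

Lemma Mmatrix_diag_ge0 (R : realFieldType) (n : nat) (M : 'M[R]_n) (i : 'I_n) :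
  (forall j, i != j -> M i j <= 0) -> 0 <= \sum_j M i j -> 0 <= M i i.
Proof.
move=> Moff Mrow; apply: le_trans Mrow _; rewrite (bigD1 i)//= -[leRHS]addr0 lerD2l.
by apply: sumr_le0 => j ji; apply: Moff; rewrite eq_sym.
Qed.

(* Both properties are inherited by the Schur complement, whose diagonal is
   smaller than the original one. *)
Lemma det_Mmatrix_bounds (R : realFieldType) (n : nat) (M : 'M[R]_n) :
  (forall i j, i != j -> M i j <= 0) -> (forall i, 0 <= \sum_j M i j) ->
  0 <= \det M <= \prod_i M i i.
Proof.
elim: n => [|n IHn] in M *; first by rewrite det_mx00 big_ord0 lexx ler01.
move=> Moff Mrow; set a := M ord0 ord0.
have Mdiag i : 0 <= M i i by apply: Mmatrix_diag_ge0 (Mrow i) => j; exact: Moff.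
have := Mrow ord0; rewrite big_ord_recl -/a => row0.
have b0 j : M ord0 (lift ord0 j) <= 0 by apply: Moff; rewrite eq_liftF.
have c0 j : M (lift ord0 j) ord0 <= 0 by apply: Moff; rewrite eq_sym eq_liftF.
(* With a zero pivot, the entries of the first row are nonpositive with a nonnegative sum, so they
   all vanish. *)
have [a0|a0] := eqVneq a 0.
  rewrite det_row0.
    by rewrite lexx/=; apply: prodr_ge0 => i _.
  move=> j; case: (unliftP ord0 j) => [k|] ->//.
  apply/eqP; rewrite eq_le b0/=.
  move: row0; rewrite a0 add0r (bigD1 k)//= => /le_trans; apply.
  by rewrite -[leRHS]addr0 lerD2l; apply: sumr_le0.
have {}a0 : 0 < a by rewrite lt_def a0 Mdiag.
have Soff i j : i != j -> schur M i j <= 0.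
  move=> ij; rewrite mxE -/a.
  have : 0 <= M (lift ord0 i) ord0 * M ord0 (lift ord0 j) / a.
    by rewrite divr_ge0 ?(ltW a0)// mulr_le0.
  have : M (lift ord0 i) (lift ord0 j) <= 0.
    by apply: Moff; rewrite (inj_eq lift_inj).
  by lra.
have Srow i : 0 <= \sum_j schur M i j.
  under eq_bigr do rewrite mxE -/a.
  rewrite big_split/= sumrN -mulr_suml -mulr_sumr.
  have := Mrow (lift ord0 i); rewrite big_ord_recl => rowi.
  (* Eliminating column 0 adds to row i a multiple of the first row's tail. By this bound the tail
     costs at most what [M (lift ord0 i) ord0] already costs, so the new row sum is at least the old
     full one. *)
  have uP : - (\sum_j M ord0 (lift ord0 j) / a) <= 1.
    by rewrite -mulr_suml -mulNr ler_pdivrMr// mul1r; lra.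
  have : - M (lift ord0 i) ord0 * (- (\sum_j M ord0 (lift ord0 j) / a)) <=
         - M (lift ord0 i) ord0.
    by rewrite ler_piMr// oppr_ge0.
  by rewrite mulrNN -mulr_suml mulrA; lra.
have /andP[det0 detle] := IHn (schur M) Soff Srow.
rewrite det_schur ?gt_eqF//; apply/andP; split; first by rewrite mulr_ge0// ltW.
rewrite big_ord_recl -/a ler_wpM2l ?(ltW a0)// (le_trans detle)//.
apply: ler_prod => i _; rewrite (Mmatrix_diag_ge0 _ (Srow i)) => [/=|j]; last exact: Soff.
by rewrite mxE -/a gerBl divr_ge0 ?(ltW a0)// mulr_le0.
Qed.

Definition psd (R : realFieldType) (n : nat) (M : 'M[R]_n) : Prop :=
  M^T = M /\ forall v : 'rV[R]_n, 0 <= (v *m M *m v^T) 0 0.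

Lemma quadE (R : realFieldType) (n : nat) (M : 'M[R]_n) (v : 'rV[R]_n) :
  (v *m M *m v^T) 0 0 = \sum_i \sum_j v 0 i * M i j * v 0 j.
Proof.
rewrite mxE exchange_big/=; apply: eq_bigr => j _.
by rewrite !mxE mulr_suml.
Qed.

Lemma psdP (R : realFieldType) (n : nat) (M : 'M[R]_n) :
  (forall i j, M i j = M j i) ->
  (forall x : 'I_n -> R, 0 <= \sum_i \sum_j x i * M i j * x j) -> psd M.
Proof.
move=> Msym Mpos; split; first by apply/matrixP => i j; rewrite mxE.
by move=> v; rewrite quadE; exact: Mpos.
Qed.

Lemma psd_sum_ge0 (R : realFieldType) (n : nat) (M : 'M[R]_n) (x : 'I_n -> R) :
  psd M -> 0 <= \sum_i \sum_j x i * M i j * x j.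
Proof.
move=> [_ /(_ (\row_i x i))]; rewrite quadE.
by under eq_bigr do under eq_bigr do rewrite !mxE.
Qed.

Lemma psd_sym (R : realFieldType) (n : nat) (M : 'M[R]_n) i j : psd M -> M i j = M j i.
Proof. by move=> [/matrixP/(_ i j)]; rewrite mxE. Qed.

Lemma quad_recl (R : realFieldType) (n : nat) (M : 'M[R]_n.+1) (x : 'I_n.+1 -> R) :
  (forall i j, M i j = M j i) ->
  \sum_i \sum_j x i * M i j * x j =
  M ord0 ord0 * x ord0 ^+ 2 +
  (x ord0 * \sum_j M ord0 (lift ord0 j) * x (lift ord0 j)) *+ 2 +
  \sum_i \sum_j x (lift ord0 i) * M (lift ord0 i) (lift ord0 j) * x (lift ord0 j).
Proof.
move=> Msym; rewrite big_ord_recl big_ord_recl.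
under [X in _ + X = _]eq_bigr do rewrite big_ord_recl.
rewrite big_split/= mulr2n -!addrA; congr (_ + _); first by ring.
rewrite mulr_sumr; congr (_ + _); first by apply: eq_bigr => j _; ring.
by congr (_ + _); apply: eq_bigr => j _; rewrite (Msym _ ord0); ring.
Qed.

Lemma sum_deltal (R : pzSemiRingType) (n : nat) (F : 'I_n -> R) k :
  \sum_i (i == k)%:R * F i = F k.
Proof.
rewrite (bigD1 k)//= big1 => [|i /negPf ->]; last by rewrite mul0r.
by rewrite eqxx mul1r addr0.
Qed.

Lemma sum_deltar (R : pzSemiRingType) (n : nat) (F : 'I_n -> R) k :
  \sum_i F i * (i == k)%:R = F k.
Proof.
rewrite (bigD1 k)//= big1 => [|i /negPf ->]; last by rewrite mulr0.
by rewrite eqxx mulr1 addr0.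
Qed.

Lemma psd_diag_ge0 (R : realFieldType) (n : nat) (M : 'M[R]_n) i : psd M -> 0 <= M i i.
Proof.
move=> /(psd_sum_ge0 (fun k => (k == i)%:R)).
by under eq_bigr do rewrite sum_deltar; rewrite sum_deltal.
Qed.

(** On the vector [(t, e_k)] the form is affine in t, and an affine function that stays nonnegative
    on the whole line has slope 0. *)
Lemma psd_row0 (R : realFieldType) (n : nat) (M : 'M[R]_n.+1) :
  psd M -> M ord0 ord0 = 0 -> forall j, M ord0 j = 0.
Proof.
move=> Mpsd M0 j; case: (unliftP ord0 j) => [k|] ->//.
set b := M _ _; set c := M (lift ord0 k) (lift ord0 k).
have c0 : 0 <= c by exact: psd_diag_ge0.
have H t : 0 <= c + (t * b) *+ 2.
  pose x i : R := if i == ord0 then t else (i == lift ord0 k)%:R.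
  have := psd_sum_ge0 x Mpsd; rewrite quad_recl => [|? ?]; last exact: psd_sym.
  rewrite M0 mul0r add0r {1}/x eqxx.
  have xl i : x (lift ord0 i) = (i == k)%:R by rewrite /x (inj_eq lift_inj).
  under eq_bigr do rewrite xl.
  under [X in _ + X]eq_bigr do under eq_bigr do rewrite !xl.
  rewrite sum_deltar; under [X in _ + X]eq_bigr do rewrite sum_deltar.
  by rewrite sum_deltal addrC.
apply/eqP/negPn/negP => b0.
have := H (- (c + 1) / b); rewrite divfK// mulr2n; lra.
Qed.

(** The form of the Schur complement at x is the form of [M] at [(- b / a, x)], the minimiser over
    the first coordinate. A zero pivot needs no exclusion: with [0^-1 = 0] both [- b / a] and the
    correction term vanish, and [schur M] is the lower right block. *)
Lemma psd_schur (R : realFieldType) (n : nat) (M : 'M[R]_n.+1) :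
  psd M -> psd (schur M).
Proof.
move=> Mpsd; have Msym i j : M i j = M j i by exact: psd_sym.
set a := M ord0 ord0; apply: psdP => [i j|x].
  rewrite !mxE (Msym (lift ord0 i) (lift ord0 j)) (Msym (lift ord0 i) ord0).
  by rewrite (Msym (lift ord0 j) ord0); congr (_ - _ / _); rewrite mulrC.
set b := \sum_j M ord0 (lift ord0 j) * x j.
have Sx : \sum_i \sum_j x i * schur M i j * x j =
   \sum_i \sum_j x i * M (lift ord0 i) (lift ord0 j) * x j - b ^+ 2 / a.
  rewrite expr2 {1}/b mulr_suml mulr_suml -sumrN -big_split/=; apply: eq_bigr => i _.
  rewrite mulr_sumr mulr_suml -sumrN -big_split/=; apply: eq_bigr => j _.
  by rewrite !mxE -/a (Msym _ ord0); ring.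
pose y i : R := if unlift ord0 i is Some k then x k else - b / a.
have y0 : y ord0 = - b / a by rewrite /y unlift_none.
have yl i : y (lift ord0 i) = x i by rewrite /y liftK.
have := psd_sum_ge0 y Mpsd; rewrite quad_recl// y0.
under eq_bigr do rewrite yl.
under [X in _ + X]eq_bigr do under eq_bigr do rewrite !yl.
rewrite -/a -/b Sx; set S := \sum_i _.
have [->|a0] := eqVneq a 0; first by rewrite invr0 !(mulr0, mul0r) mul0rn !add0r subr0.
suff -> : a * (- b / a) ^+ 2 + (- b / a * b) *+ 2 + S = S - b ^+ 2 / a by [].
by field.
Qed.

(** Hadamard's inequality by elimination: each step lowers the remaining diagonal entries by a
    square over the pivot. *)
Lemma det_psd_bounds (R : realFieldType) (n : nat) (M : 'M[R]_n) :
  psd M -> 0 <= \det M <= \prod_i M i i.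
Proof.
elim: n => [|n IHn] in M *; first by rewrite det_mx00 big_ord0 lexx ler01.
move=> Mpsd; set a := M ord0 ord0.
have a0 : 0 <= a by exact: psd_diag_ge0.
have [az|an] := eqVneq a 0.
  rewrite det_row0; last by move=> j; exact: psd_row0.
  by rewrite lexx/=; apply: prodr_ge0 => i _; exact: psd_diag_ge0.
have /andP[det0 detle] := IHn _ (psd_schur Mpsd).
rewrite det_schur// mulr_ge0//= big_ord_recl -/a ler_wpM2l// (le_trans detle)//.
apply: ler_prod => i _; rewrite (psd_diag_ge0 _ (psd_schur Mpsd))/= mxE gerBl.
by rewrite divr_ge0// (psd_sym _ _ Mpsd) -expr2 sqr_ge0.
Qed.

(** Cholesky factorisation, singular matrices included: a zero pivot comes with a zero row, for
    which the factor also gets a zero row. *)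
Lemma psd_gram (R : rcfType) (n : nat) (M : 'M[R]_n) :
  psd M -> exists L : 'M[R]_n, forall i j, M i j = \sum_k L k i * L k j.
Proof.
elim: n => [|n IHn] in M *; first by exists 0 => -[].
move=> Mpsd; have [L HL] := IHn _ (psd_schur Mpsd).
have Msym i j : M i j = M j i by exact: psd_sym.
set a := M ord0 ord0.
have a0 : 0 <= a by exact: psd_diag_ge0.
pose u j := if a == 0 then 0 else M ord0 j / Num.sqrt a.
pose v k j := if unlift ord0 j is Some j' then L k j' else 0.
exists (\matrix_(k, j) if unlift ord0 k is Some k' then v k' j else u j) => i j.
rewrite big_ord_recl !mxE unlift_none.
under eq_bigr do rewrite !mxE liftK.
have uu : u i * u j = M ord0 i * M ord0 j / a.
  rewrite /u; case: eqVneq => [->|an]; first by rewrite invr0 !mulr0.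
  by rewrite mulrACA -invfM -expr2 sqr_sqrtr.
have M0 : a = 0 -> forall k, M ord0 k = 0 by move=> az k; exact: psd_row0.
rewrite uu; case: (unliftP ord0 i) => [i'|] ->; last first.
  rewrite big1 => [|k _]; last by rewrite /v unlift_none mul0r.
  rewrite addr0 -/a; have [az|an] := eqVneq a 0; first by rewrite az invr0 mulr0 M0.
  by rewrite mulrAC divff// mul1r.
case: (unliftP ord0 j) => [j'|] ->; last first.
  rewrite big1 => [|k _]; last by rewrite /v unlift_none mulr0.
  rewrite addr0 -/a Msym; have [az|an] := eqVneq a 0; first by rewrite az invr0 mulr0 M0.
  by rewrite mulfK.
under eq_bigr do rewrite /v !liftK.
by rewrite -HL mxE -/a (Msym _ ord0) addrC subrK.
Qed.

(** * Determinants with optional rows *)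

Section MixedDeterminant.
Variables (R : comNzRingType) (T : Type) (K : T -> T -> R) (x0 : T).

(* In a list of triples [(b, a, x)], [(1, 0, x)] stands for a point left out of
   the minor and [(0, 1, x)] for a point kept; the determinant is linear in each
   pair [(b, a)]. *)
Definition mixmx n (l : seq (R * R * T)) : 'M[R]_n :=
  \matrix_(i, j) let e := nth (0, 0, x0) l i in
    e.1.1 * (i == j)%:R + e.1.2 * K e.2 (nth (0, 0, x0) l j).2.

Definition detK (s : seq T) : R :=
  \det (\matrix_(i < size s, j < size s) K (nth x0 s i) (nth x0 s j)).

Lemma nth_lift (U : Type) (u0 u : U) (p l : seq U) n (i0 : 'I_n.+1) (i : 'I_n) :
  i0 = size p :> nat -> nth u0 (p ++ u :: l) (lift i0 i) = nth u0 (p ++ l) i.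
Proof.
move=> i0p; rewrite !nth_cat /= /bump i0p.
case: (leqP (size p) i) => ip.
  by rewrite add1n ltnNge leqW//= subSn.
by rewrite add0n ip.
Qed.

(** Row [size p] is b times a unit vector plus a times the kernel row. Expanding the determinant
    along the unit vector deletes the point x. *)
Lemma det_mixmx_row n p l b a x : (size p <= n)%N ->
  \det (mixmx n.+1 (p ++ (b, a, x) :: l)) =
  b * \det (mixmx n (p ++ l)) + a * \det (mixmx n.+1 (p ++ (0, 1, x) :: l)).
Proof.
rewrite -ltnS => pn; set M := mixmx n.+1 _; set M' := mixmx n.+1 _.
pose i0 := Ordinal pn.
pose B : 'M[R]_n.+1 := \matrix_(i, j) if i == i0 then (j == i0)%:R else M i j.
have nthi0 e : nth (0, 0, x0) (p ++ e :: l) i0 = e by rewrite nth_cat/= ltnn subnn.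
have nth2 (e e' : R * R * T) (j : 'I_n.+1) : e.2 = e'.2 ->
    (nth (0, 0, x0) (p ++ e :: l) j).2 = (nth (0, 0, x0) (p ++ e' :: l) j).2.
  move=> ee; have [->|] := eqVneq j i0; first by rewrite !nthi0.
  by rewrite eq_sym => /unlift_some[k -> _]; rewrite !nth_lift.
rewrite (@determinant_multilinear _ _ M B M' i0 b a); last 3 first.
- apply/rowP => j; rewrite !mxE eqxx !nthi0/= mul0r add0r mul1r.
  by rewrite (nth2 (b, a, x) (0, 1, x))// (eq_sym j).
- by apply/matrixP => i j; rewrite !mxE (eq_sym _ i0) (negPf (neq_lift _ _)).
- apply/matrixP => i j; rewrite !mxE !nth_lift//.
  by rewrite (nth2 (0, 1, x) (b, a, x)).
congr (b * _ + _); rewrite (expand_det_row _ i0) (bigD1 i0)//= big1 => [|j /negPf ji].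
  rewrite mxE !eqxx mul1r addr0 /cofactor -signr_odd addnn odd_double mul1r.
  congr (\det _); apply/matrixP => i j; rewrite !mxE (eq_sym _ i0) (negPf (neq_lift _ _)).
  by rewrite !nth_lift// (inj_eq lift_inj).
by rewrite mxE eqxx ji mul0r.
Qed.

(** A sum over all sublists of [l], weighted by the product of the weights kept: the discrete
    counterpart of [psi] below, with the sample points fixed. *)
Fixpoint subsum (l : seq (R * T)) (g : seq T -> R) : R :=
  if l is e :: l' then subsum l' g + e.1 * subsum l' (fun s => g (e.2 :: s))
  else g [::].

Lemma eq_subsum l g g' : g =1 g' -> subsum l g = subsum l g'.
Proof.
by elim: l => [|e l IH]/= in g g' * => gg' //; congr (_ + _ * _); apply: IH => // s.
Qed.

(** The prefix [p] collects the points already kept, which is what makes the induction on [l] go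
    through. *)
Lemma subsum_detK_prefix p l :
  subsum l (fun s => detK (p ++ s)) =
  \det (mixmx (size p + size l)
         ([seq (0, 1, x) | x <- p] ++ [seq (1, e.1, e.2) | e <- l])).
Proof.
elim: l => [|e l IH] /= in p *.
  rewrite /detK !cats0 addn0; congr (\det _); apply/matrixP => i j; rewrite !mxE.
  by rewrite !(nth_map x0)//= mul0r add0r mul1r.
rewrite addnS det_mixmx_row ?size_map ?leq_addr// mul1r IH; congr (_ + _ * _).
under eq_subsum do rewrite -cat_rcons.
by rewrite IH map_rcons cat_rcons size_rcons addSn.
Qed.

(** The expansion of [det (1 + D K)], D diagonal, into principal minors. *)
Lemma subsum_detK l : subsum l detK = \det (\matrix_(i < size l, j < size l)
  ((i == j)%:R + (nth (0, x0) l i).1 * K (nth (0, x0) l i).2 (nth (0, x0) l j).2)).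
Proof.
rewrite (subsum_detK_prefix [::])/=; congr (\det _); apply/matrixP => i j; rewrite !mxE.
by rewrite !(nth_map (0, x0))//= mul1r.
Qed.

End MixedDeterminant.

(** * The Gaussian kernel matrix *)

Local Open Scope classical_set_scope.
Local Open Scope ring_scope.

(* The entrywise n-th power of a Gram matrix is the Gram matrix of the tensor powers. *)
Lemma gram_power_ge0 (R : realFieldType) (k d n : nat) (y : 'I_k -> 'I_d -> R) (c : 'I_k -> R) :
  0 <= \sum_i \sum_j c i * (\sum_a y i a * y j a) ^+ n * c j.
Proof.
have gramX i j : (\sum_a y i a * y j a) ^+ n =
    \sum_(f : {ffun 'I_n -> 'I_d}) (\prod_b y i (f b)) * (\prod_b y j (f b)).
  rewrite -[n in LHS]card_ord -prodr_const bigA_distr_bigA.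
  by apply: eq_bigr => f _; rewrite big_split.
have -> : \sum_i \sum_j c i * (\sum_a y i a * y j a) ^+ n * c j =
    \sum_(f : {ffun 'I_n -> 'I_d}) (\sum_i c i * \prod_b y i (f b)) ^+ 2.
  under eq_bigr do under eq_bigr do rewrite gramX mulr_sumr mulr_suml.
  under eq_bigr do rewrite exchange_big/=.
  rewrite exchange_big/=; apply: eq_bigr => f _.
  rewrite expr2 mulr_suml; apply: eq_bigr => i _.
  by rewrite mulr_sumr; apply: eq_bigr => j _; ring.
by apply: sumr_ge0 => f _; exact: sqr_ge0.
Qed.

Lemma cvg_rsum (R : realType) (I : Type) (r : seq I) (f : I -> nat -> R) (l : I -> R) :
  (forall i, f i @ \oo --> l i) ->
  (fun n => \sum_(i <- r) f i n) @ \oo --> \sum_(i <- r) l i.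
Proof.
move=> fl; elim: r => [|i r IH].
  by rewrite big_nil; under eq_fun do rewrite big_nil; exact: cvg_cst.
by rewrite big_cons; under eq_fun do rewrite big_cons; exact: cvgD.
Qed.

(** The partial sums of the exponential series are nonnegative combinations of entrywise powers of a
    Gram matrix, and nonnegativity of the form survives the limit. *)
Lemma psd_expR_gram (R : realType) (k d : nat) (y : 'I_k -> 'I_d -> R) :
  psd (\matrix_(i, j) expR (\sum_a y i a * y j a)).
Proof.
apply: psdP => [i j|c]; first by rewrite !mxE; congr expR; apply: eq_bigr => a _; rewrite mulrC.
pose G i j := \sum_a y i a * y j a.
pose u N := \sum_i \sum_j c i * series (exp_coeff (G i j)) N * c j.
have ucvg : u @ \oo --> \sum_i \sum_j c i * expR (G i j) * c j.
  apply: cvg_rsum => i; apply: cvg_rsum => j; apply: cvgMl; apply: cvgMr.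
  exact: is_cvg_series_exp_coeff.
under eq_bigr do under eq_bigr do rewrite mxE.
rewrite -[leRHS](cvg_lim _ ucvg)//; apply: limr_ge; first by apply/cvg_ex; eexists; exact: ucvg.
apply: nearW => N; rewrite /u /series/=.
under eq_bigr do under eq_bigr do rewrite mulr_sumr mulr_suml.
under eq_bigr do rewrite exchange_big/=.
rewrite exchange_big/=; apply: sumr_ge0 => n _.
under eq_bigr do under eq_bigr do rewrite /exp_coeff mulrA -mulrA [_^-1 * _]mulrC mulrA.
under eq_bigr do rewrite -mulr_suml.
by rewrite -mulr_suml mulr_ge0 ?invr_ge0// gram_power_ge0.
Qed.

Section GaussianKernel.
Variables (R : realType) (d : nat) (Sigma : 'M[R]_d).
Hypothesis Spos : posdef Sigma.

Lemma posdef_unitmx : Sigma \in unitmx.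
Proof.
rewrite unitmxE unitfE; apply/negP => /det0P [v v0 vS].
by have := Spos.2 _ v0; rewrite vS mul0mx mxE ltxx.
Qed.

Lemma psd_invmx : psd (invmx Sigma).
Proof.
have ST := Spos.1; have SU := posdef_unitmx.
split=> [|v]; first by rewrite trmx_inv ST.
have -> : v *m invmx Sigma *m v^T =
    (v *m invmx Sigma) *m Sigma *m (v *m invmx Sigma)^T.
  by rewrite trmx_mul trmx_inv ST mulmxKV// mulmxA.
have [->|v0] := eqVneq (v *m invmx Sigma) 0; first by rewrite !mul0mx mxE.
exact/ltW/Spos.2.
Qed.

(** With [Sigma^-1 = L^T L] the kernel depends on [L (x - y)] through a sum of squares. Symmetry,
    bounds, positivity and the Lipschitz estimate are all read off from this form. *)
Lemma gaussK_gram : exists L : 'M[R]_d, forall x y : d.-tuple R,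
  gaussK Sigma x y = expR (- (1 / 2) *
    \sum_k (\sum_i L k i * (tnth x i - tnth y i)) ^+ 2).
Proof.
have [L HL] := psd_gram psd_invmx; exists L => x y; congr (expR (_ * _)).
rewrite quadE.
under [RHS]eq_bigr do rewrite expr2 mulr_suml.
rewrite [RHS]exchange_big/=; apply: eq_bigr => i _.
under [RHS]eq_bigr do rewrite mulr_sumr.
rewrite [RHS]exchange_big/=; apply: eq_bigr => j _.
rewrite HL !mxE mulr_sumr mulr_suml; apply: eq_bigr => k _; ring.
Qed.

Lemma gaussKxx (x : d.-tuple R) : gaussK Sigma x x = 1.
Proof. by rewrite /gaussK subrr mul0mx mul0mx mxE mulr0 expR0. Qed.

Lemma gaussK_ge0 (x y : d.-tuple R) : 0 <= gaussK Sigma x y.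
Proof. exact: expR_ge0. Qed.

(** Expanding the square gives [K(x, y) = e(x) exp <Lx, Ly> e(y)], a diagonal rescaling of a
    positive semidefinite matrix. Its diagonal is 1, so Hadamard's inequality bounds the minor by
    1. *)
Lemma rho_bounds k (xs : seq (d.-tuple R)) : 0 <= rho Sigma k xs <= 1.
Proof.
pose x (i : 'I_k) := nth (origin R d) xs i.
have [L HL] := gaussK_gram.
pose y (i : 'I_k) a := \sum_b L a b * tnth (x i) b.
pose e i := expR (- (1 / 2) * \sum_a y i a ^+ 2).
have KE i j : gaussK Sigma (x i) (x j) = e i * expR (\sum_a y i a * y j a) * e j.
  rewrite HL /e -!expRD; congr expR.
  rewrite !mulr_sumr -!big_split/=; apply: eq_bigr => a _.
  have -> : \sum_b L a b * (tnth (x i) b - tnth (x j) b) = y i a - y j a.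
    by rewrite /y -sumrB; apply: eq_bigr => b _; rewrite mulrBr.
  by field.
have /det_psd_bounds : psd (\matrix_(i < k, j < k) gaussK Sigma (x i) (x j)).
  apply: psdP => [i j|c].
    rewrite !mxE !KE mulrAC [RHS]mulrAC (mulrC (e i)); congr (_ * expR _).
    by apply: eq_bigr => a _; rewrite mulrC.
  under eq_bigr do under eq_bigr do rewrite mxE KE !mulrA -mulrA.
  have := psd_sum_ge0 (fun i => c i * e i) (psd_expR_gram y).
  congr (0 <= _); apply: eq_bigr => i _; apply: eq_bigr => j _.
  by rewrite mxE (mulrC (c j)).
by rewrite (eq_bigr (fun=> 1)) ?big1_eq// => i _; rewrite mxE gaussKxx.
Qed.

End GaussianKernel.

(** * Lebesgue measure on tuples *)

Section LebesgueTuple.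
Variable R : realType.
Local Notation leb := (@lebesgue_measure R).

Definition tcons n (p : measurableTypeR R * n.-tuple R) : n.+1.-tuple R := [tuple of p.1 :: p.2].

Lemma measurable_tcons n : measurable_fun [set: measurableTypeR R * n.-tuple R] (@tcons n).
Proof. exact: measurable_cons. Qed.

Definition cube n (k : R) : set (n.-tuple R) := [set x | forall i, `|tnth x i| <= k].

Lemma measurable_cube n k : measurable (@cube n k).
Proof.
have -> : @cube n k = \bigcap_(i in [set: 'I_n]) ((@tnth n R ^~ i) @^-1` [set t | `|t| <= k]).
  by apply/seteqP; split=> x/= xk i; [move=> _|]; exact: xk.
apply: fin_bigcap_measurable => // i _; rewrite -[X in measurable X]setTI.
apply: measurable_tnth => //; rewrite (_ : [set t | _] = `[-k, k]%classic)//.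
by apply/seteqP; split => t /=; rewrite in_itv/= ler_norml.
Qed.

Section LebesgueCons.
Variables (n : nat) (mu : {sigma_finite_measure set (n.-tuple R) -> \bar R}).

Definition lebcons := pushforward (lebesgue_measure \x mu)%E (@tcons n).

Let lebcons0 : lebcons set0 = 0%E.
Proof. by rewrite /lebcons /pushforward preimage_set0 measure0. Qed.
Let lebcons_ge0 A : (0 <= lebcons A)%E.
Proof. by rewrite /lebcons /pushforward; exact: measure_ge0. Qed.
Let lebcons_sigma_additive : semi_sigma_additive lebcons.
Proof.
move=> F mF tF mUF; rewrite /lebcons /pushforward preimage_bigcup.
apply: measure_sigma_additive => [i|].
  by rewrite -[X in measurable X]setTI; exact: measurable_tcons.
apply/trivIsetP => /= i j _ _ ij; rewrite -preimage_setI.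
by move/trivIsetP : tF => /(_ _ _ _ _ ij) ->//; rewrite preimage_set0.
Qed.

HB.instance Definition _ := isMeasure.Build _ _ _ lebcons
  lebcons0 lebcons_ge0 lebcons_sigma_additive.
End LebesgueCons.

(** [lebint] is only an iterated integral; realising it by a measure opens up Tonelli's theorem and
    the algebra of integrals. Finiteness on cubes gives sigma-finiteness of that measure at the next
    dimension, and later the finite volume of balls. *)
Lemma lebint_measure_exists n : exists mu : {sigma_finite_measure set (n.-tuple R) -> \bar R},
  (forall f : n.-tuple R -> \bar R, measurable_fun [set: n.-tuple R] f ->
     (forall x, (0 <= f x)%E) -> lebint f = (\int[mu]_x f x)%E) /\
  (forall k, (mu (cube k) < +oo)%E).
Proof.
elim: n => [|n [mu [muE muC]]].
  exists \d_([tuple] : 0.-tuple R); split => [f mf f0|k].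
    by rewrite integral_dirac//= diracT mul1e.
  by rewrite /dirac/= ltry.
have mC k : (lebcons mu (cube k) < +oo)%E.
  rewrite /lebcons /pushforward.
  have -> : @tcons n @^-1` cube k = `[- k, k]%classic `*` cube k.
    apply/seteqP; split=> -[t y]/=.
      move=> H; split => [|i]; first by have := H ord0; rewrite tnth0 in_itv/= ler_norml.
      by have := H (lift ord0 i); rewrite tnthS.
    move=> [tk yk] i; case: (unliftP ord0 i) => [j ->|->]; first by rewrite tnthS; exact: yk.
    by move: tk; rewrite tnth0 in_itv/= ler_norml.
  rewrite product_measure1E//; last exact: measurable_cube.
  have lebk : (leb `[(- k)%R, k]%classic < +oo)%E.
    by rewrite lebesgue_measure_itv/=; case: ifPn => _; rewrite -?EFinB ltry.
  by apply: lte_mul_pinfty => //; rewrite ge0_fin_numE.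
have sf : sigma_finite setT (lebcons mu).
  exists (fun k => cube k%:R); last by move=> k; split; [exact: measurable_cube|exact: mC].
  apply/esym; rewrite -subTset => x _; rewrite /bigcup/=.
  exists (\max_(i < n.+1) (Num.truncn `|tnth x i|).+1)%N => //= i.
  rewrite (le_trans (ltW (truncnS_gt _)))// ler_nat.
  exact: (leq_bigmax i).
pose H := Measure_isSigmaFinite.Build _ _ _ (lebcons mu) sf.
pose m : {sigma_finite_measure set _ -> \bar R} := HB.pack (lebcons mu) H.
exists m; split => //= f mf f0.
have mE : (\int[lebcons mu]_x f x = \int[(leb \x mu)%E]_x (f \o @tcons n) x)%E.
  have := ge0_integral_pushforward (@measurable_tcons n) (leb \x mu)%E measurableT mf.
  by rewrite preimage_setT => <-.
rewrite [RHS]mE fubini_tonelli1//=.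
  apply: eq_integral => t _; apply: muE => //.
  by apply: measurableT_comp => //; exact: measurable_cons.
by apply: measurableT_comp => //; exact: measurable_tcons.
Qed.

Definition lebn n := projT1 (cid (lebint_measure_exists n)).

Lemma lebintE n (f : n.-tuple R -> \bar R) : measurable_fun [set: n.-tuple R] f ->
  (forall x, (0 <= f x)%E) -> lebint f = (\int[lebn n]_x f x)%E.
Proof. by move=> mf f0; rewrite (proj1 (projT2 (cid (lebint_measure_exists n)))). Qed.

Lemma lebn_cube n k : (lebn n (cube k) < +oo)%E.
Proof. exact: (proj2 (projT2 (cid (lebint_measure_exists n)))). Qed.

Lemma lebvolE n (A : set (n.-tuple R)) : measurable A -> lebvol A = lebn n A.
Proof.
move=> mA; rewrite /lebvol lebintE.
- by rewrite integral_indic// setIT.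
- exact/measurable_EFinP/measurable_indic.
- by move=> x; rewrite lee_fin.
Qed.

(** By uniqueness of Lebesgue measure: c times its image under [t -> c t + b] has the right value on
    half-open intervals. *)
Lemma ge0_integral_affine (c b : R) (f : R -> \bar R) : 0 < c ->
  measurable_fun [set: R] f -> (forall x, (0 <= f x)%E) ->
  (\int[leb]_t f (c * t + b)%R = (c^-1)%:E * \int[leb]_t f t)%E.
Proof.
move=> c0 mf f0.
pose phi (t : measurableTypeR R) : measurableTypeR R := c * t + b.
have mphi : measurable_fun [set: measurableTypeR R] phi.
  by apply: measurable_funD => //; exact: measurable_funM.
have cge0 : 0 <= c by exact: ltW.
pose m : {measure set (measurableTypeR R) -> \bar R} :=
  measure_function_pushforward__canonical__measure_function_Measure leb mphi.
have mE A : measurable A -> leb A = mscale (NngNum cge0) m A.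
  apply: lebesgue_measure_unique => _ [[u v] _ <-]/=.
  rewrite /mscale/= /pushforward.
  have -> : phi @^-1` `]u, v] = `](u - b) / c, (v - b) / c]%classic.
    by apply/seteqP; split=> t /=; rewrite !in_itv/= ltr_pdivrMr// ler_pdivlMr// ltrBlDr lerBrDr mulrC.
  rewrite !lebesgue_measure_itv/= !lte_fin ltr_pM2r ?invr_gt0// ltrD2r.
  case: ifPn => _; last by rewrite mule0.
  by rewrite -!EFinB -EFinM; congr EFin; field; rewrite gt_eqF.
rewrite [in RHS](eq_measure_integral (mscale (NngNum cge0) m)) => [|A mA _]; last exact: mE.
rewrite ge0_integral_mscale//= muleA -EFinM mulVf ?gt_eqF// mul1e.
have := ge0_integral_pushforward mphi leb measurableT mf.
by rewrite preimage_setT => ->.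
Qed.

Lemma measurable_fun_lebint d (T : measurableType d) n (f : T * n.-tuple R -> \bar R) :
  measurable_fun [set: T * n.-tuple R] f -> (forall x, (0 <= f x)%E) ->
  measurable_fun [set: T] (fun t => lebint (fun y => f (t, y))).
Proof.
move=> mf f0; rewrite (_ : (fun _ => _) = fubini_F (lebn n) f).
  exact: measurable_fun_fubini_tonelli_F.
by apply/funext => t; rewrite lebintE//; exact: measurableT_comp.
Qed.

Lemma eq_lebint n (f g : n.-tuple R -> \bar R) : f =1 g -> lebint f = lebint g.
Proof. by move=> fg; congr lebint; apply/funext. Qed.

Lemma lebint_ge0 n (f : n.-tuple R -> \bar R) : (forall x, (0 <= f x)%E) -> (0 <= lebint f)%E.
Proof.
elim: n f => [|n IH] f f0 /=; first exact: f0.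
by apply: integral_ge0 => t _; exact: IH.
Qed.

Definition affine n (c : R) (b y : n.-tuple R) : n.-tuple R :=
  [tuple c * tnth y i + tnth b i | i < n].

Lemma lebint_affine n (c : R) (b : n.-tuple R) (f : n.-tuple R -> \bar R) : 0 < c ->
  measurable_fun [set: n.-tuple R] f -> (forall x, (0 <= f x)%E) ->
  lebint (fun y => f (affine c b y)) = ((c ^- n)%:E * lebint f)%E.
Proof.
move=> c0; elim: n b f => [|n IH] b f mf f0 /=.
  by rewrite expr0 invr1 mul1e (tuple0 (affine c b _)).
case/tupleP: b => b0 b.
have mfc t : measurable_fun [set: n.-tuple R] (fun y => f [tuple of t :: y]).
  by apply: measurableT_comp => //; exact: measurable_cons.
transitivity (\int[leb]_t ((c ^- n)%:E * lebint (fun y => f [tuple of (c * t + b0)%R :: y])))%E.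
  apply: eq_integral => t _; rewrite -(IH b)//; apply: eq_lebint => y.
  congr f; apply: eq_from_tnth => i; rewrite tnth_mktuple.
  by case: (unliftP ord0 i) => [j|] ->; rewrite ?tnthS ?tnth0 ?tnth_mktuple.
have cn : 0 <= c ^- n by rewrite invr_ge0 exprn_ge0 ?ltW.
have mg : measurable_fun [set: R] (fun t => lebint (fun y => f [tuple of t :: y])).
  apply: (@measurable_fun_lebint _ (measurableTypeR R) _ (f \o @tcons n)) => [|x].
    by apply: measurableT_comp => //; exact: measurable_tcons.
  exact: f0.
pose h t := lebint (fun y => f [tuple of (c * t + b0)%R :: y]).
have mh : measurable_fun [set: R] h.
  apply: (measurableT_comp mg).
  by apply: measurable_funD => //; exact: measurable_funM.
rewrite (@ge0_integralZl_EFin _ _ _ leb _ measurableT h (fun t _ => lebint_ge0 (fun y => f0 _)) mh _ cn).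
rewrite (@ge0_integral_affine c b0 (fun t => lebint (fun y => f [tuple of t :: y])))//.
  by rewrite muleA -EFinM -invfM exprSr.
by move=> t; exact: lebint_ge0.
Qed.

Lemma measurable_eball n r : measurable (@eball R n r).
Proof.
rewrite (_ : eball r = (fun x : n.-tuple R => \sum_(i < n) tnth x i ^+ 2) @^-1` `]-oo, r ^+ 2]).
  rewrite -[X in measurable X]setTI.
  have : measurable_fun [set: n.-tuple R] (fun x : n.-tuple R => \sum_(i < n) tnth x i ^+ 2).
    apply: measurable_sum => i; apply: measurable_funX; exact: measurable_tnth.
  by apply.
by apply/seteqP; split => x /=; rewrite in_itv.
Qed.

Lemma lebvol_eball n (r : R) : 0 < r ->
  lebvol (@eball R n r) = (lebvol (@eball R n 1) * (r ^+ n)%:E)%E.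
Proof.
move=> r0; have rn : r ^+ n != 0 by rewrite expf_neq0// gt_eqF.
have mI : measurable_fun [set: n.-tuple R] (fun x => (\1_(@eball R n r) x : R)%:E).
  apply/measurable_EFinP; apply: measurable_indic; exact: measurable_eball.
have I0 x : (0 <= (\1_(@eball R n r) x : R)%:E)%E by rewrite lee_fin.
have -> : lebvol (@eball R n 1) = ((r ^- n)%:E * lebvol (@eball R n r))%E.
  rewrite /lebvol -(lebint_affine [tuple 0 | _ < n] r0 mI I0).
  apply: eq_lebint => x; rewrite !indicE; congr ((nat_of_bool _)%:R)%:E.
  have -> : (affine r [tuple 0 | _ < n] x \in eball r) = (r ^+ 2 * \sum_(i < n) tnth x i ^+ 2 <= r ^+ 2).
    rewrite mulr_sumr; apply/idP/idP; rewrite inE /eball/=.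
      by under eq_bigr do rewrite !tnth_mktuple addr0 exprMn.
    by under [X in _ -> X <= _]eq_bigr do rewrite !tnth_mktuple addr0 exprMn.
  rewrite (ger_pMr _ (exprn_gt0 2 r0)) .
  by apply/idP/idP; rewrite inE /eball/= (expr1n R 2).
by rewrite muleC muleA -EFinM (divff rn) mul1e.
Qed.

Lemma eball_sub_cube n (r : R) : 0 <= r -> @eball R n r `<=` cube r.
Proof.
move=> r0 x xr i; rewrite -(@ler_pXn2r _ 2)// ?nnegrE// real_normK ?num_real//.
by apply: le_trans xr; rewrite (bigD1 i)//= lerDl sumr_ge0// => j _; exact: sqr_ge0.
Qed.

Lemma lebvol_eball_lty n (r : R) : 0 <= r -> (lebvol (@eball R n r) < +oo)%E.
Proof.
move=> r0; rewrite lebvolE; last exact: measurable_eball.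
apply: le_lt_trans (lebn_cube n r); apply: le_measure; rewrite ?inE.
- exact: measurable_eball.
- exact: measurable_cube.
- exact: eball_sub_cube.
Qed.

End LebesgueTuple.

(** * The Gaussian integral *)

Section GaussianIntegral.
Variable R : realType.
Local Notation leb := (@lebesgue_measure R).

Lemma integral_expR_sqr (a b : R) : 0 < a ->
  (\int[leb]_t (expR (- (1 / 2) * (a * (t + b) ^+ 2)))%:E)%E = (Num.sqrt (2 * pi / a))%:E.
Proof.
(* This c turns the exponent into [- (c t + c b)^2], the form of [gauss_fun]. *)
move=> a0; pose c := Num.sqrt (a / 2).
have c0 : 0 < c by rewrite sqrtr_gt0 divr_gt0.
have cc : c ^+ 2 = a / 2 by rewrite sqr_sqrtr// divr_ge0// ltW.
transitivity (\int[leb]_t (gauss_fun (c * t + c * b))%:E)%E.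
  apply: eq_integral => t _; congr (expR _)%:E.
  by rewrite -mulrDr exprMn cc; field.
have mg : measurable_fun [set: R] (fun t : R => (gauss_fun t)%:E).
  by apply/measurable_EFinP; exact: measurable_gauss_fun.
have g0 (t : R) : (0 <= (gauss_fun t)%:E)%E by rewrite lee_fin gauss_fun_ge0.
rewrite (ge0_integral_affine (c * b) c0 mg g0) integralT_gauss -EFinM; congr EFin.
have -> : 2 * pi / a = pi / c ^+ 2 :> R by rewrite cc; field; rewrite gt_eqF.
by rewrite sqrtrM ?pi_ge0// sqrtrV ?sqr_ge0// sqrtr_sqr gtr0_norm// mulrC.
Qed.

Definition quad n (Q : 'M[R]_n) (y : n.-tuple R) : R :=
  \sum_i \sum_j tnth y i * Q i j * tnth y j.

Lemma measurable_quad n (Q : 'M[R]_n) : measurable_fun [set: n.-tuple R] (quad Q).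
Proof.
apply: measurable_sum => i; apply: measurable_sum => j.
apply: measurable_funM; last exact: measurable_tnth.
apply: measurable_funM => //; exact: measurable_tnth.
Qed.

Lemma measurable_gauss_quad n (Q : 'M[R]_n) :
  measurable_fun [set: n.-tuple R] (fun y => (expR (- (1 / 2) * quad Q y))%:E).
Proof.
apply/measurable_EFinP; apply: measurableT_comp => //.
by apply: measurable_funM => //; exact: measurable_quad.
Qed.

Lemma quad_tcons n (Q : 'M[R]_n.+1) (t : R) (y : n.-tuple R) : psd Q -> Q ord0 ord0 != 0 ->
  quad Q [tuple of t :: y] = Q ord0 ord0 *
    (t + (\sum_j Q ord0 (lift ord0 j) * tnth y j) / Q ord0 ord0) ^+ 2 + quad (schur Q) y.
Proof.
move=> Qpsd Q0; rewrite /quad quad_recl; last by move=> i j; exact: psd_sym.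
rewrite tnth0; under eq_bigr do rewrite tnthS.
under [X in _ + X = _]eq_bigr do under eq_bigr do rewrite !tnthS.
set a := Q ord0 ord0 in Q0 *; set b := \sum_j Q ord0 _ * _.
have -> : \sum_i \sum_j tnth y i * schur Q i j * tnth y j =
   \sum_i \sum_j tnth y i * Q (lift ord0 i) (lift ord0 j) * tnth y j - b ^+ 2 / a.
  rewrite expr2 {1}/b mulr_suml mulr_suml -sumrN -big_split/=; apply: eq_bigr => i _.
  rewrite mulr_sumr mulr_suml -sumrN -big_split/=; apply: eq_bigr => j _.
  by rewrite !mxE -/a (psd_sym _ ord0 Qpsd); ring.
by field.
Qed.

Lemma lebint_gauss n (Q : 'M[R]_n) : psd Q -> \det Q != 0 ->
  lebint (fun y => (expR (- (1 / 2) * quad Q y))%:E) = (Num.sqrt ((2 * pi) ^+ n / \det Q))%:E.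
Proof.
elim: n => [|n IH] in Q *.
  by move=> _ _; rewrite /= /quad big_ord0 mulr0 expR0 det_mx00 expr0 divr1 sqrtr1.
move=> Qpsd Qdet; set a := Q ord0 ord0.
have aN0 : a != 0.
  by apply: contra_neq Qdet => a0; apply: det_row0 => j; exact: psd_row0.
have a0 : 0 < a by rewrite lt_def aN0 psd_diag_ge0.
move: Qdet; rewrite det_schur// mulf_eq0 negb_or -/a => /andP[_ Sdet].
have Spsd := psd_schur Qpsd.
pose b y := (\sum_j Q ord0 (lift ord0 j) * tnth y j) / a.
pose f (p : measurableTypeR R * n.-tuple R) : \bar R :=
  (expR (- (1 / 2) * (a * (p.1 + b p.2) ^+ 2)) * expR (- (1 / 2) * quad (schur Q) p.2))%:E.
have fE p : f p = (expR (- (1 / 2) * quad Q (tcons p)))%:E.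
  by rewrite quad_tcons// mulrDr expRD.
have mf : measurable_fun [set: measurableTypeR R * n.-tuple R] f.
  rewrite (funext fE); exact: (measurableT_comp (measurable_gauss_quad Q) (@measurable_tcons R n)).
have f0 p : (0 <= f p)%E by rewrite lee_fin mulr_ge0 ?expR_ge0.
transitivity (\int[leb]_t \int[lebn R n]_y f (t, y))%E.
  apply: eq_integral => t _; rewrite -lebintE//; first by apply: eq_lebint => y; rewrite fE.
  exact: measurableT_comp.
(* [lebint] integrates the head coordinate last, but the completed square must be integrated over
   the head first. *)
rewrite (fubini_tonelli (m1 := lebesgue_measure) f mf f0).
transitivity (\int[lebn R n]_y ((Num.sqrt (2 * pi / a))%:E * (expR (- (1 / 2) * quad (schur Q) y))%:E))%E.
  apply: eq_integral => y _; rewrite -(integral_expR_sqr (b y) a0).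
  have mh : measurable_fun [set: R] (fun t => (expR (- (1 / 2) * (a * (t + b y) ^+ 2)))%:E).
    apply/measurable_EFinP; apply: measurableT_comp => //; apply: measurable_funM => //.
    by apply: measurable_funM => //; apply: measurable_funX; exact: measurable_funD.
  have h0 (t : R) : (0 <= (expR (- (1 / 2) * (a * (t + b y) ^+ 2)))%:E)%E.
    by rewrite lee_fin expR_ge0.
  have e0 : (0 <= (expR (- (1 / 2) * quad (schur Q) y))%:E)%E by rewrite lee_fin expR_ge0.
  by rewrite -(ge0_integralZr leb measurableT mh (fun t _ => h0 t) e0).
have e0 (y : n.-tuple R) : (0 <= (expR (- (1 / 2) * quad (schur Q) y))%:E)%E.
  by rewrite lee_fin expR_ge0.
have me := measurable_gauss_quad (schur Q).
rewrite (ge0_integralZl (lebn R n) measurableT me (fun y _ => e0 y)); last first.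
  by rewrite lee_fin sqrtr_ge0.
rewrite -(lebintE me e0).
have pa : 0 <= 2 * pi / a by rewrite divr_ge0 ?(ltW a0)// mulr_ge0// pi_ge0.
rewrite IH// -EFinM -(sqrtrM _ pa).
by congr (Num.sqrt _)%:E; rewrite exprS; field; rewrite Sdet aN0.
Qed.

(** The normalisation of [Sigma] makes [K(x, .)] a probability density; the row sums of the M-matrix
    rest on this. *)
Lemma lebint_gaussK d (Sigma : 'M[R]_d) (x : d.-tuple R) : posdef Sigma ->
  (2 * pi) `^ (d%:R / 2) * Num.sqrt (\det Sigma) = 1 ->
  lebint (fun y => (gaussK Sigma x y)%:E) = 1%E.
Proof.
move=> Spos Snorm; have SU := posdef_unitmx Spos.
have Qdet : \det (invmx Sigma) != 0 by rewrite -unitfE -unitmxE unitmx_inv.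
have -> : (fun y => (gaussK Sigma x y)%:E) = (fun y =>
    (expR (- (1 / 2) * quad (invmx Sigma) (affine 1 [tuple - tnth x i | i < d] y)))%:E).
  apply/funext => y; congr (expR (_ * _))%:E; rewrite quadE.
  apply: eq_bigr => i _; apply: eq_bigr => j _; rewrite !mxE !tnth_mktuple; ring.
have e0 (y : d.-tuple R) : (0 <= (expR (- (1 / 2) * quad (invmx Sigma) y))%:E)%E.
  by rewrite lee_fin expR_ge0.
rewrite (lebint_affine _ ltr01 (measurable_gauss_quad (invmx Sigma)) e0).
rewrite expr1n invr1 mul1e (lebint_gauss (psd_invmx Spos) Qdet).
rewrite det_inv invrK sqrtrM ?exprn_ge0 ?mulr_ge0 ?pi_ge0//.
have pi2 : 0 <= 2 * pi :> R by rewrite mulr_ge0// pi_ge0.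
have <- : (2 * pi) `^ (d%:R / 2) = Num.sqrt ((2 * pi) ^+ d) :> R.
  by rewrite powRrM powR12_sqrt ?powR_ge0// powR_mulrn.
by rewrite Snorm.
Qed.

End GaussianIntegral.

(** * Integrated determinantal expansions *)

Section BoundedIntegrals.
Context d (T : measurableType d) (R : realType) (mu : {measure set T -> \bar R}).
Variables (c : set T) (mc : measurable c) (fc : (mu c < +oo)%E).

Lemma bounded_integrable (u : T -> R) (M : R) : measurable_fun [set: T] u ->
  (forall x, `|u x| <= M) -> mu.-integrable c (EFin \o u).
Proof.
move=> mu_ uM; apply: (@le_integrable _ _ _ mu c mc _ (cst M%:E)).
- by apply/measurable_EFinP; exact: measurable_funTS.
- by move=> x _ /=; rewrite lee_fin (le_trans (uM x))// ler_norm.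
- apply/integrableP; split; first exact: measurable_cst.
  rewrite integral_cst//=; apply: lte_mul_pinfty => //.
Qed.

Lemma Rintegral_bound (u : T -> R) (M : R) : measurable_fun [set: T] u ->
  (forall x, `|u x| <= M) -> `|\int[mu]_(x in c) u x| <= M * fine (mu c).
Proof.
move=> mu_ uM; have iu := bounded_integrable mu_ uM.
apply: le_trans (le_normr_Rintegral mc iu) _.
rewrite -[leRHS](@Rintegral_cst _ _ _ mu)//; apply: le_Rintegral => //.
- exact: (integrable_norm iu).
- apply: (@bounded_integrable _ `|M|) => //.
Qed.

Lemma integrable_scale (v : R) (u : T -> R) : mu.-integrable c (EFin \o u) ->
  mu.-integrable c (EFin \o (fun x => v * u x)).
Proof. by move=> iu; have := integrableZl mc v iu. Qed.

End BoundedIntegrals.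

Lemma measurable_Rintegral d1 d2 (T1 : measurableType d1) (T2 : measurableType d2)
  (R : realType) (mu : {sigma_finite_measure set T2 -> \bar R}) (c : set T2)
  (F : T1 * T2 -> R) (M : R) : measurable c -> (mu c < +oo)%E ->
  measurable_fun [set: T1 * T2] F -> (forall p, `|F p| <= M) ->
  measurable_fun [set: T1] (fun t => \int[mu]_(x in c) F (t, x)).
Proof.
move=> mc fc mF FM.
(* Adding [M] makes the integrand nonnegative, as Tonelli's measurability statement requires; the
   constant contributes [M mu(c)], subtracted afterwards. *)
pose G (p : T1 * T2) : \bar R := ((F p + M) * \1_c p.2)%:E.
have mG : measurable_fun [set: T1 * T2] G.
  apply/measurable_EFinP; apply: measurable_funM; first exact: measurable_funD.
  by apply: measurableT_comp => //; exact: measurable_indic.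
have G0 p : (0 <= G p)%E.
  rewrite lee_fin mulr_ge0//; have := FM p; rewrite ler_norml => /andP[]; lra.
have mFt t : measurable_fun [set: T2] (fun x => F (t, x)) by exact: measurableT_comp.
have -> : (fun t => \int[mu]_(x in c) F (t, x)) =
    (fun t => fine (fubini_F mu G t) - M * fine (mu c)).
  apply/funext => t; rewrite /fubini_F.
  have -> : (\int[mu]_y G (t, y))%E = (\int[mu]_(y in c) (F (t, y) + M)%R%:E)%E.
    rewrite [RHS]integral_mkcond; apply: eq_integral => y _.
    by rewrite /G/= patchE indicE; case: ifP; rewrite (mulr1, mulr0).
  rewrite -/(Rintegral mu c (fun y => F (t, y) + M)) RintegralD//.
  - by rewrite Rintegral_cst// addrK.
  - exact: (bounded_integrable mc fc (mFt t) (fun x => FM (t, x))).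
  - exact: (@bounded_integrable _ _ _ mu c mc fc _ `|M|).
apply: measurable_funB => //; apply: measurableT_comp => //.
exact: measurable_fun_fubini_tonelli_F.
Qed.

(** * Mixed integrals over lists of cells *)

Section Psi.
Variables (R : realType) (d : nat).
Local Notation pt := (d.-tuple R).
Local Notation mu := (lebn R d).

Definition vol (c : set pt) : R := fine (mu c).

Definition okset (c : set pt) := measurable c /\ (mu c < +oo)%E.

Fixpoint okl (l : seq (R * R * set pt)) : Prop :=
  if l is e :: l' then okset e.2 /\ okl l' else True.

(* When [g] is the correlation function of a point process, [psi l g] is the
   expectation of the product over [l] of [b + a N(c)]. *)
Fixpoint psi (l : seq (R * R * set pt)) (g : seq pt -> R) : R :=
  if l is e :: l' then
    e.1.1 * psi l' g + e.1.2 * \int[mu]_(x in e.2) psi l' (fun s => g (x :: s))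
  else g [::].

(* Joint measurability of [g] in the entries of its argument, tested through all
   measurable parametrisations since [seq pt] carries no sigma-algebra here. *)
Definition smeas (g : seq pt -> R) :=
  forall (dT : measure_display) (T : measurableType dT) k (fs : nat -> T -> pt),
    (forall i, measurable_fun [set: T] (fs i)) ->
    measurable_fun [set: T] (fun t => g (mkseq (fs ^~ t) k)).

Definition sbd (M : R) (g : seq pt -> R) := forall s, `|g s| <= M.

Lemma mkseqSl (T : Type) (f : nat -> T) k : mkseq f k.+1 = f 0 :: mkseq (f \o S) k.
Proof. by rewrite /mkseq/= -[1%N]addn0 iotaDl -map_comp. Qed.

Lemma smeas_cons g x : smeas g -> smeas (fun s => g (x :: s)).
Proof.
move=> mg dT T k fs mfs.
pose fs' i := if i is j.+1 then fs j else cst x.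
rewrite (_ : (fun t => _) = fun t => g (mkseq (fs' ^~ t) k.+1)); last first.
  by apply/funext => t; rewrite mkseqSl.
by apply: mg => -[|i] //=.
Qed.

Lemma smeas_cat g p : smeas g -> smeas (fun s => g (p ++ s)).
Proof.
by elim: p g => [|x p IH] g mg //=; apply: (IH (fun s => g (x :: s))); exact: smeas_cons.
Qed.

Definition wt (l : seq (R * R * set pt)) : R :=
  \prod_(e <- l) (`|e.1.1| + `|e.1.2| * vol e.2).

Lemma vol_ge0 c : 0 <= vol c. Proof. exact: fine_ge0. Qed.

(** The two claims are proved together because each feeds the other: the bound on an integral uses
    measurability of the integrand, and measurability of an integral in its parameters uses
    boundedness. *)
Lemma psi_meas_bound l : okl l -> forall g M, smeas g -> sbd M g ->
  (forall (dT : measure_display) (T : measurableType dT) k (fs : nat -> T -> pt),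
    (forall i, measurable_fun [set: T] (fs i)) ->
    measurable_fun [set: T] (fun t => psi l (fun s => g (mkseq (fs ^~ t) k ++ s)))) /\
  `|psi l g| <= M * wt l.
Proof.
elim: l => [|[[b a] c] l IH]/=.
  move=> _ g M mg gM; split => [dT T k fs mfs|]; last by rewrite /wt big_nil mulr1.
  by under eq_fun do rewrite cats0; exact: mg.
move=> [[mc fc] okl'] g M mg gM.
have IHx p := IH okl' (fun s => g (p ++ s)) M (smeas_cat p mg) (fun s => gM _).
have [mpsi bpsi] := IH okl' g M mg gM.
have bx p : `|psi l (fun s => g (p ++ s))| <= M * wt l by exact: (IHx p).2.
have mx : measurable_fun [set: pt] (fun x => psi l (fun s => g (x :: s))).
  by have := mpsi _ _ 1%N (fun=> id) (fun=> @measurable_id _ _ _).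
split => [dT T k fs mfs|].
  apply: measurable_funD; apply: measurable_funM => //; first exact: mpsi.
  pose F (p : T * pt) := psi l (fun s => g (mkseq (fs ^~ p.1) k ++ p.2 :: s)).
  have FE p : F p = psi l (fun s => g (rcons (mkseq (fs ^~ p.1) k) p.2 ++ s)).
    by congr psi; apply/funext => s; rewrite cat_rcons.
  apply: (@measurable_Rintegral _ _ _ _ _ _ _ F (M * wt l)) => // [|p]; last by rewrite FE.
  (* The integration variable becomes one more parameter, in position k. *)
  pose fs' i (p : T * pt) := if (i < k)%N then fs i p.1 else p.2.
  rewrite (_ : F = fun p => psi l (fun s => g (mkseq (fs' ^~ p) k.+1 ++ s))).
    apply: mpsi => i; rewrite /fs'; case: (i < k)%N; last exact: measurable_snd.
    by apply: (measurableT_comp (mfs i)).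
  apply/funext => p; rewrite FE; congr psi; apply/funext => s; congr (g (_ ++ s)).
  rewrite /mkseq -addn1 iotaD map_cat/= cats1 /fs' ltnn; congr rcons.
  by apply/eq_in_map => i; rewrite mem_iota/= => ->.
rewrite /wt big_cons/= -/(wt l); set W := wt l in bx bpsi *.
have := Rintegral_bound mc fc mx (fun x => bx [:: x]).
set I := \int[_]_(x in c) _ => IM.
rewrite (le_trans (ler_normD _ _))// !normrM [leRHS](_ : _ = `|b| * (M * W) + `|a| * (M * W * vol c)); last by ring.
by rewrite lerD// ler_wpM2l.
Qed.

Lemma psi_measurable l g M : okl l -> smeas g -> sbd M g ->
  measurable_fun [set: pt] (fun x => psi l (fun s => g (x :: s))).
Proof.
move=> ol mg gM; have [+ _] := psi_meas_bound ol mg gM.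
by move=> /(_ _ _ 1%N (fun=> id) (fun=> @measurable_id _ _ _)).
Qed.

Lemma psi_bound l g M : okl l -> smeas g -> sbd M g -> `|psi l g| <= M * wt l.
Proof. by move=> ol mg gM; exact: (psi_meas_bound ol mg gM).2. Qed.

Lemma psi_integrable l c g M : okl l -> okset c -> smeas g -> sbd M g ->
  mu.-integrable c (EFin \o (fun x => psi l (fun s => g (x :: s)))).
Proof.
move=> ol [mc fc] mg gM; apply: (bounded_integrable mc fc (psi_measurable ol mg gM)) => x.
exact: (psi_bound ol (smeas_cons x mg) (fun s => gM _)).
Qed.

Lemma psi_linear l v g h M M' : okl l -> smeas g -> sbd M g -> smeas h -> sbd M' h ->
  psi l (fun s => g s + v * h s) = psi l g + v * psi l h.
Proof.
move=> + + + + +; elim: l g h => [|[[b a] c] l IH]//= g h [oc ol] mg gM mh hM.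
rewrite IH//; under eq_Rintegral => x _ do
  rewrite (IH (fun s => g (x :: s)) (fun s => h (x :: s)) ol (smeas_cons x mg)
    (fun s => gM _) (smeas_cons x mh) (fun s => hM _)).
have ih := psi_integrable ol oc mh hM.
rewrite RintegralD//; last 3 first.
- exact: oc.1.
- exact: (psi_integrable ol oc mg gM).
- exact: (integrable_scale oc.1).
rewrite RintegralZl//; last exact: oc.1.
ring.
Qed.

(** Linearity in the pair [(b, a)] at any position, the integral analogue of [det_mixmx_row]. *)
Lemma psi_insert p b a c l g M : okl (p ++ (b, a, c) :: l) -> smeas g -> sbd M g ->
  psi (p ++ (b, a, c) :: l) g = b * psi (p ++ l) g + a * psi (p ++ (0, 1, c) :: l) g.
Proof.
elim: p g => [|[[b' a'] c'] p IH] g /=; first by move=> _ _ _; rewrite mul0r add0r mul1r.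
move=> [oc' op] mg gM.
have [opl oc1] : okl (p ++ l) /\ okl (p ++ (0, 1, c) :: l).
  by elim: p op {IH} => [[]//|? ? IH]/= [? /IH[]].
rewrite IH//; under eq_Rintegral => x _ do
  rewrite (IH (fun s => g (x :: s)) op (smeas_cons x mg) (fun s => gM _)).
have i1 := psi_integrable opl oc' mg gM.
have i2 := psi_integrable oc1 oc' mg gM.
rewrite RintegralD//; [|exact: oc'.1|exact: (integrable_scale oc'.1)|exact: (integrable_scale oc'.1)].
rewrite !RintegralZl//; [ring|exact: oc'.1|exact: oc'.1].
Qed.

End Psi.

Section PsiApplications.
Variables (R : realType) (d : nat).
Local Notation pt := (d.-tuple R).
Local Notation mu := (lebn R d).

Lemma psi_scale l v (g : seq pt -> R) M : okl l -> smeas g -> sbd M g ->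
  psi l (fun s => v * g s) = v * psi l g.
Proof.
move=> ol mg gM; rewrite (_ : (fun s => _) = fun s => g s + (v - 1) * g s).
  by rewrite (psi_linear _ ol mg gM mg gM); ring.
by apply/funext => s; ring.
Qed.

Lemma psi_ge0 l (g : seq pt -> R) :
  (forall b a c, (b, a, c) \in l -> 0 <= b /\ 0 <= a) ->
  (forall s, 0 <= g s) -> 0 <= psi l g.
Proof.
elim: l g => [|[[b a] c] l IH]//= g ol g0; have [b0 a0] := ol _ _ _ (mem_head _ _).
have ol' b' a' c' : (b', a', c') \in l -> 0 <= b' /\ 0 <= a'.
  by move=> bl; apply: (ol b' a' c'); rewrite inE bl orbT.
rewrite addr_ge0 ?mulr_ge0// ?IH//.
by apply: Rintegral_ge0 => x _; apply: IH.
Qed.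

Lemma okl_mkseq k (A : nat -> set pt) (b a : R) :
  (forall i, (i < k)%N -> okset (A i)) -> okl (mkseq (fun i => (b, a, A i)) k).
Proof.
elim: k A => [//|k IH] A okA; rewrite mkseqSl; split; first exact: (okA 0%N isT).
by apply: (IH (A \o S)) => i ik; exact: (okA i.+1).
Qed.

Lemma kint_psi k (A : nat -> set pt) (g : seq pt -> R) M :
  (forall i, (i < k)%N -> okset (A i)) -> smeas g -> sbd M g -> (forall s, 0 <= g s) ->
  kint k (fun xs => (\prod_(i < k) (\1_(A i) (nth (origin R d) xs i))%:E * (g xs)%:E)%E) =
  (psi (mkseq (fun i => (0, 1, A i)) k) g)%:E.
Proof.
elim: k A g M => [|k IH] A g M okA mg gM g0.
  by rewrite /= big_ord0 mul1e.
rewrite mkseqSl; set l := mkseq _ k.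
have ol : okl l.
  by apply: (@okl_mkseq _ (A \o S)) => i ik; exact: (okA i.+1).
pose u x := psi l (fun s => g (x :: s)).
have mA0 : measurable (A 0%N) by exact: (okA 0%N isT).1.
transitivity (lebint (fun x => (\1_(A 0%N) x * u x)%:E)).
  apply: eq_lebint => x.
  have mgx := smeas_cons x mg.
  (* The indicator of the head is absorbed into the integrand, which stays nonnegative and bounded
     by [M], so the induction hypothesis applies to it. *)
  rewrite -(psi_scale _ ol mgx (fun s => gM _)).
  have I01 : `|\1_(A 0%N) x : R| <= 1 by rewrite indicE; case: (_ \in _); rewrite ?normr1 ?normr0.
  rewrite -(IH _ _ M)//.
  - congr kint; apply/funext => s.
    rewrite big_ord_recl/= EFinM muleA; congr (_ * _)%E.
    by rewrite muleC; congr (_ * _)%E; apply: eq_bigr => i _.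
  - by move=> i ik; exact: (okA i.+1).
  - move=> dT T j fs mfs; apply: measurable_funM => //; exact: mgx.
  - by move=> s; rewrite normrM (le_trans (ler_piMl _ I01)).
  - by move=> s; rewrite mulr_ge0.
have u0 x : 0 <= u x.
  apply: psi_ge0 => // b a c /mapP[i _ [-> -> _]]; by rewrite ler01.
have mu_ := psi_measurable ol mg gM.
rewrite lebintE; last 2 first.
- by apply/measurable_EFinP; apply: measurable_funM => //; exact: measurable_indic.
- by move=> x; rewrite lee_fin mulr_ge0.
rewrite /= mul0r add0r mul1r /Rintegral fineK.
  rewrite [RHS]integral_mkcond; apply: eq_integral => x _.
  by rewrite patchE indicE; case: ifP; rewrite (mul1r, mul0r).
apply: integrable_fin_num => //.
exact: (psi_integrable ol (okA 0%N isT) mg gM).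
Qed.

(* One point of each cell; a null cell, which may be empty, contributes the dummy
   point [origin]. *)
Fixpoint adm (l : seq (R * set pt)) (xs : seq pt) : Prop :=
  match l, xs with
  | [::], [::] => True
  | e :: l', x :: xs' => (vol e.2 = 0 /\ x = origin R d \/ e.2 x) /\ adm l' xs'
  | _, _ => False
  end.

Definition wlist (l : seq (R * set pt)) (xs : seq pt) : seq (R * pt) :=
  zip [seq e.1 * vol e.2 | e <- l] xs.

(* Averaging over the cells: if [psi] exceeded [C], so would the integrand at
   some choice of one point per cell. *)
Lemma psi_average (l : seq (R * set pt)) (g : seq pt -> R) (C M : R) :
  okl [seq (1, e.1, e.2) | e <- l] -> smeas g -> sbd M g ->
  (forall xs, adm l xs -> subsum (wlist l xs) g <= C) ->
  psi [seq (1, e.1, e.2) | e <- l] g <= C.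
Proof.
elim: l g M => [|[a c] l IH] g M /=; first by move=> _ _ _ /(_ [::]); apply.
move=> [oc ol] mg gM gC; rewrite mul1r.
set L := map _ l in ol *.
have bu x := psi_bound ol (smeas_cons x mg) (fun s => gM (x :: s)).
have mu_ := psi_measurable ol mg gM.
have iu := psi_integrable ol oc mg gM.
have [v0|v0] := eqVneq (vol c) 0.
  have : `|\int[mu]_(x in c) psi L (fun s => g (x :: s))| <= 0.
    by rewrite (le_trans (Rintegral_bound oc.1 oc.2 mu_ bu))// -/(vol c) v0 mulr0.
  rewrite normr_le0 => /eqP ->; rewrite mulr0 addr0.
  apply: (IH g M ol mg gM) => xs xsl.
  have := gC (origin R d :: xs) (conj (or_introl (conj v0 erefl)) xsl).
  by rewrite /wlist/= v0 mulr0 mul0r addr0.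
have vp : 0 < vol c by rewrite lt_def v0 vol_ge0.
(* For a fixed x the left-hand side is [psi L] of the single function [g s + a |c| g (x :: s)], to
   which the induction hypothesis applies. Dividing by [|c|] and integrating over c then gives the
   claim. *)
have key x : c x -> psi L g + a * vol c * psi L (fun s => g (x :: s)) <= C.
  move=> cx; rewrite -(psi_linear _ ol mg gM (smeas_cons x mg) (fun s => gM (x :: s))).
  apply: (IH _ (M + `|a * vol c| * M)) => //.
  - move=> dT T k fs mfs; apply: measurable_funD; first exact: mg.
    by apply: measurable_funM => //; apply: (smeas_cons x mg).
  - by move=> s; rewrite (le_trans (ler_normD _ _))// normrM lerD// ler_wpM2l.
  - move=> xs xsl; have := gC (x :: xs) (conj (or_intror cx) xsl).
    rewrite /wlist/=; set z := zip _ _; move=> H; apply: le_trans H.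
    have lin : forall (y : seq (R * pt)) h h' (v : R),
        subsum y (fun s => h s + v * h' s) = subsum y h + v * subsum y h'.
      elim=> [//|[w y'] y IHy] h h' v /=.
      by rewrite IHy (IHy (fun s => h (y' :: s))); ring.
    by rewrite lin.
rewrite -lerBrDl -(RintegralZl a oc.1 iu).
have -> : C - psi L g = (C - psi L g) / vol c * vol c by rewrite divfK.
rewrite -(@Rintegral_cst _ _ _ mu)//; last exact: oc.1.
apply: le_Rintegral.
- exact: oc.1.
- exact: (integrable_scale oc.1).
- by apply: (@bounded_integrable _ _ _ _ _ oc.1 oc.2 _ `|(C - psi L g) / vol c|).
- move=> x cx; rewrite ler_pdivlMr// lerBrDl mulrAC; exact: key.
Qed.

Lemma measurable_prodr (dT : measure_display) (T : measurableType dT) (I : Type) (s : seq I)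
  (h : I -> T -> R) : (forall i, measurable_fun [set: T] (h i)) ->
  measurable_fun [set: T] (fun t => \prod_(i <- s) h i t).
Proof.
move=> mh; elim: s => [|i s IH]; first by under eq_fun do rewrite big_nil; exact: measurable_cst.
by under eq_fun do rewrite big_cons; exact: measurable_funM.
Qed.

Lemma measurable_gaussK (Sigma : 'M[R]_d) (dT : measure_display) (T : measurableType dT)
  (f h : T -> pt) :
  measurable_fun [set: T] f -> measurable_fun [set: T] h ->
  measurable_fun [set: T] (fun t => gaussK Sigma (f t) (h t)).
Proof.
move=> mf mh; rewrite /gaussK; apply: measurableT_comp => //.
apply: measurable_funM => //; under eq_fun do rewrite quadE.
have mfi (i : 'I_d) : measurable_fun [set: T] (fun t => tnth (f t) i - tnth (h t) i).
  apply: measurable_funB; first exact: (measurableT_comp (measurable_tnth i) mf).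
  exact: (measurableT_comp (measurable_tnth i) mh).
apply: measurable_sum => i; apply: measurable_sum => j.
under eq_fun do rewrite !mxE.
by apply: measurable_funM => //; apply: measurable_funM.
Qed.

Definition rhos (Sigma : 'M[R]_d) (s : seq pt) : R := rho Sigma (size s) s.

Lemma smeas_rhos (Sigma : 'M[R]_d) : smeas (rhos Sigma).
Proof.
move=> dT T k fs mfs; rewrite /rhos /rho.
under eq_fun do rewrite size_mkseq.
rewrite /determinant; apply: measurable_sum => s; apply: measurable_funM => //.
apply: measurable_prodr => i; under eq_fun do rewrite mxE !nth_mkseq//.
exact: measurable_gaussK.
Qed.

Lemma sbd_rhos (Sigma : 'M[R]_d) : posdef Sigma -> sbd 1 (rhos Sigma).
Proof.
move=> Sp s; have /andP[r0 r1] := rho_bounds Sp (size s) s.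
by rewrite ger0_norm.
Qed.

End PsiApplications.

(** * Counting points in cells *)

Section Counts.
Variables (R : realType) (T : eqType) (K : finType) (idx : T -> K) (s : seq T).

Let cnt k := count (fun x => idx x == k) s.

Lemma sum_count_fibers : (\sum_k cnt k)%N = size s.
Proof.
rewrite /cnt; elim: s => [|x t IH] /=; first by rewrite big1.
by rewrite big_split/= IH (bigD1 (idx x))//= eqxx big1 ?addn0// => k /negPf; rewrite eq_sym => ->.
Qed.

Lemma bernoulli_ineq (a : R) n : 0 <= a -> 1 + a * n%:R <= (1 + a) ^+ n.
Proof.
move=> a0; elim: n => [|n IH]; first by rewrite mulr0 addr0 expr0.
rewrite exprSr; apply: le_trans (ler_wpM2r _ IH); last by rewrite addr_ge0.
have := mulr_ge0 (mulr_ge0 a0 a0) (ler0n R n); rewrite -natr1; lra.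
Qed.

(** When the cells separate the points, every count is 0 or 1, and there [1 + a m = (1 + a)^m]. *)
Lemma prod_count_inj (a : R) : uniq s -> {in s &, injective idx} ->
  \prod_k (1 + a * (cnt k)%:R) = (1 + a) ^+ size s.
Proof.
move=> us inj; rewrite -sum_count_fibers expr_sum; apply: eq_bigr => k _.
have : (cnt k <= 1)%N.
  rewrite /cnt -size_filter; case E : [seq x <- s | idx x == k] => [//|x t]; rewrite -E.
  have : x \in [seq x <- s | idx x == k] by rewrite E mem_head.
  rewrite mem_filter => /andP[/eqP xk xs].
  apply: (@uniq_leq_size _ _ [:: x]); first exact: filter_uniq.
  move=> y; rewrite mem_filter inE => /andP[/eqP yk ys].
  by apply/eqP; apply: inj => //; rewrite yk.
by case: (cnt k) => [|[|]]//= _; rewrite ?(mulr0, mulr1, addr0, expr0, expr1).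
Qed.

(** Bernoulli's inequality in each cell. The bound does not depend on the partition, so it can
    dominate along a refining mesh. *)
Lemma prod_count_bound (a : R) : `|\prod_k (1 + a * (cnt k)%:R)| <= (1 + `|a|) ^+ size s.
Proof.
rewrite -sum_count_fibers expr_sum normr_prod; apply: ler_prod => k _.
rewrite normr_ge0/= (le_trans (ler_normD _ _))// normr1 normrM normr_nat bernoulli_ineq//.
Qed.

End Counts.

Lemma size_fset_setI (T : choiceType) (A : set T) (p : pred T) : finite_set A ->
  size (fset_set (A `&` [set x | p x])) = count p (fset_set A).
Proof.
move=> fA; rewrite -size_filter; apply: perm_size; apply: uniq_perm.
- exact: fset_uniq.
- exact/filter_uniq/fset_uniq.
move=> x; rewrite mem_filter.
have fAp : finite_set (A `&` [set x | p x]) by apply: finite_setIl.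
have e1 := in_fset_set fAp; have e2 := in_fset_set fA.
rewrite e1 e2; apply/idP/idP; rewrite inE/=.
  by move=> [Ax px]; rewrite px inE.
by move=> /andP[px]; rewrite inE.
Qed.

(** * Mixed moments of the cell counts *)

Section Process.
Variables (R : realType) (d : nat) (Sigma : 'M[R]_d) (Spos : posdef Sigma).
Context (dO : measure_display) (Omega : measurableType dO) (P : probability Omega R).
Variables (X : Omega -> set (d.-tuple R)) (hX : gaussian_dpp P Sigma X).
Variables (r : R).
Local Notation pt := (d.-tuple R).
Local Notation ball := (@eball R d r).

Definition npts (c : set pt) (w : Omega) : R := fine (npoints (X w) c).

Lemma finite_ball w : finite_set (X w `&` ball).
Proof. exact: hX.1.1. Qed.

Definition pts w : {fset pt} := fset_set (X w `&` ball).

Lemma npointsE (p : pred pt) w :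
  npoints (X w) (ball `&` [set x | p x]) = (count p (pts w))%:R%:E.
Proof.
rewrite /npoints setIA /counting asboolT; last exact: (finite_setIl _ (finite_ball w)).
by rewrite size_fset_setI//; exact: finite_ball.
Qed.

Lemma npoints_ball w : npoints (X w) ball = (size (pts w))%:R%:E.
Proof. by rewrite /npoints /counting asboolT//; exact: finite_ball. Qed.

Lemma measurable_npts c : measurable c -> measurable_fun [set: Omega] (npts c).
Proof. by move=> mc; apply: measurableT_comp => //; exact: hX.1.2. Qed.

Section Cells.
Variables (K : finType) (idx : pt -> K).
Hypothesis midx : forall k, measurable [set x | idx x = k].

Definition cell k := ball `&` [set x | idx x == k].

Lemma measurable_cell k : measurable (cell k).
Proof.
apply: measurableI; first exact: measurable_eball.
by rewrite (_ : [set x | _] = [set x | idx x = k])//; apply/seteqP; split=> x /= /eqP.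
Qed.

Hypothesis r0 : 0 <= r.

Lemma okset_cell k : okset (cell k).
Proof.
split; first exact: measurable_cell.
have := @lebvol_eball_lty R d r r0; rewrite lebvolE; last exact: measurable_eball.
apply: le_lt_trans; apply: le_measure; rewrite ?inE; last exact: subIsetl.
- exact: measurable_cell.
- exact: measurable_eball.
Qed.

Lemma cell_disj k k' : k != k' -> cell k `&` cell k' = set0.
Proof.
move=> kk; apply/seteqP; split => // x [[_ /eqP xk] [_ /eqP xk']].
by move: kk; rewrite -xk -xk' eqxx.
Qed.

Lemma npts_cell k w : npts (cell k) w = (count (fun x => idx x == k) (pts w))%:R.
Proof. by rewrite /npts npointsE. Qed.

Lemma npts_cell_ge0 k w : 0 <= npts (cell k) w.
Proof. by rewrite npts_cell. Qed.

Lemma kint_ext k (F G : seq pt -> \bar R) :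
  (forall s, size s = k -> F s = G s) -> kint k F = kint k G.
Proof.
elim: k F G => [|k IH] F G FG /=; first exact: FG.
by apply: eq_lebint => x; apply: IH => s sk; apply: FG => /=; rewrite sk.
Qed.

Definition mandatory (p : seq K) : seq (R * R * set pt) := [seq (0, 1, cell k) | k <- p].

Lemma moment_cells (p : seq K) : uniq p ->
  P.-integrable [set: Omega] (EFin \o (fun w => \prod_(k <- p) npts (cell k) w)) /\
  \int[P]_w (\prod_(k <- p) npts (cell k) w) = psi (mandatory p) (rhos Sigma).
Proof.
(* The correlation identity is given for [0 < k] only; for the empty list both sides are 1. *)
case: p => [_|k0 p' up].
  have -> : (fun w => \prod_(k <- [::]) npts (cell k) w) = cst 1.
    by apply/funext => w; rewrite big_nil.
  split; first exact: finite_measure_integrable_cst.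
  by rewrite Rintegral_cst//= probability_setT /rhos/= /rho det_mx00 mulr1.
set p := k0 :: p' in up *; pose A i := cell (nth k0 p i).
have mprod : measurable_fun [set: Omega] (fun w => \prod_(k <- p) npts (cell k) w).
  by apply: measurable_prodr => k; apply: measurable_npts; exact: measurable_cell.
have prod0 w : 0 <= \prod_(k <- p) npts (cell k) w.
  by apply: prodr_ge0 => k _; exact: npts_cell_ge0.
have E : (\int[P]_w (\prod_(k <- p) npts (cell k) w)%:E)%E = (psi (mandatory p) (rhos Sigma))%:E.
  have -> : mandatory p = mkseq (fun i => (0, 1, A i)) (size p).
    by rewrite /mandatory -{1}(mkseq_nth k0 p) /mkseq -map_comp.
  rewrite -(@kint_psi _ _ _ A _ 1); last 4 first.
  - by move=> i _; exact: okset_cell.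
  - exact: smeas_rhos.
  - exact: sbd_rhos.
  - by move=> s; have /andP[] := rho_bounds Spos (size s) s.
  (* [rhos] reads the order of the minor off the list, [rho] takes it as an argument; [kint] only
     evaluates lists of the matching length. *)
  rewrite (kint_ext (G := fun xs => (\prod_(i < size p) (\1_(A i) (nth (origin R d) xs i))%:E *
     (rho Sigma (size p) xs)%:E)%E)); last by move=> s sp; rewrite /rhos sp.
  rewrite -(hX.2 (size p) A)//.
  - apply: eq_integral => w _; rewrite (big_nth k0) big_mkord -prodEFin.
    by apply: eq_bigr => i _; rewrite npts_cell /A npointsE.
  - by move=> i _; exact: measurable_cell.
  - move=> i j ip jp /eqP ij; apply: cell_disj.
    by rewrite nth_uniq.
split; last by rewrite /Rintegral E.
apply/integrableP; split; first exact/measurable_EFinP.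
have -> : (\int[P]_w `|(EFin \o (fun w => (\prod_(k <- p) npts (cell k) w)%R)) w|)%E =
   (\int[P]_w (\prod_(k <- p) npts (cell k) w)%R%:E)%E.
  by apply: eq_integral => w _; rewrite /= ger0_norm.
by rewrite E ltry.
Qed.

Definition optional (a : R) (l : seq K) : seq (R * R * set pt) := [seq (1, a, cell k) | k <- l].

Lemma okl_cat p l : okl (p ++ l) <-> okl p /\ @okl R d l.
Proof. by elim: p => [|e p IH]/=; [split=> [|[]]|rewrite IH; tauto]. Qed.

Lemma okl_mandatory p : okl (mandatory p).
Proof. by elim: p => [//|k p IH]; split => //; exact: okset_cell. Qed.

Lemma okl_optional a p : okl (optional a p).
Proof. by elim: p => [//|k p IH]; split => //; exact: okset_cell. Qed.

(** Expanding one factor [1 + a N(c)] either drops the cell or makes it mandatory, which is the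
    recursion of [psi_insert]. Integrability is carried along so that the expectation can be
    split. *)
Lemma expectation_cells (a : R) (l p : seq K) : uniq (p ++ l) ->
  P.-integrable [set: Omega] (EFin \o (fun w =>
    (\prod_(k <- p) npts (cell k) w) * \prod_(k <- l) (1 + a * npts (cell k) w))) /\
  \int[P]_w ((\prod_(k <- p) npts (cell k) w) * \prod_(k <- l) (1 + a * npts (cell k) w)) =
    psi (mandatory p ++ optional a l) (rhos Sigma).
Proof.
elim: l p => [|k l IH] p.
  rewrite !cats0 => /moment_cells[ip Ep].
  have -> : (fun w => \prod_(k <- p) npts (cell k) w *
      \prod_(k <- [::]) (1 + a * npts (cell k) w)) = (fun w => \prod_(k <- p) npts (cell k) w).
    by apply/funext => w; rewrite big_nil mulr1.
  by split.
move=> u.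
have u1 : uniq (p ++ l).
  by apply: subseq_uniq u; apply: cat_subseq => //; exact: subseq_cons.
have u2 : uniq (rcons p k ++ l) by rewrite cat_rcons.
have [i1 E1] := IH p u1; have [i2 E2] := IH (rcons p k) u2.
have -> : (fun w => \prod_(k <- p) npts (cell k) w *
      \prod_(k <- k :: l) (1 + a * npts (cell k) w)) =
    (fun w => \prod_(k <- p) npts (cell k) w * \prod_(k <- l) (1 + a * npts (cell k) w) +
     a * (\prod_(k <- rcons p k) npts (cell k) w * \prod_(k <- l) (1 + a * npts (cell k) w))).
  by apply/funext => w; rewrite big_cons big_rcons/=; ring.
have i3 := @integrable_scale _ _ _ _ _ measurableT a _ i2.
split.
  by have := integrableD measurableT i1 i3.
rewrite RintegralD// RintegralZl// E1 E2.
have ol : okl (mandatory p ++ (1, a, cell k) :: optional a l).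
  by apply/okl_cat; split; [exact: okl_mandatory|split; [exact: okset_cell|exact: okl_optional]].
rewrite [RHS](psi_insert ol (@smeas_rhos _ _ Sigma) (sbd_rhos Spos)) mul1r.
by rewrite /mandatory map_rcons cat_rcons.
Qed.

Definition cprod (a : R) w : R := \prod_k (1 + a * npts (cell k) w).

Lemma expectation_cprod a :
  P.-integrable [set: Omega] (EFin \o cprod a) /\
  \int[P]_w cprod a w = psi (optional a (index_enum K)) (rhos Sigma).
Proof.
have [] := @expectation_cells a (index_enum K) [::]; first exact: index_enum_uniq.
have -> : (fun w => \prod_(k <- [::]) npts (cell k) w *
    \prod_(k <- index_enum K) (1 + a * npts (cell k) w)) = cprod a.
  by apply/funext => w; rewrite big_nil mul1r.
by [].
Qed.

Lemma sum_vol_cells : \sum_k vol (cell k) = vol ball.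
Proof.
have mb := @measurable_eball R d r.
have -> : vol ball = fine (\sum_k lebn R d (cell k))%E.
  rewrite /vol; congr fine.
  have -> : lebn R d ball = (\int[lebn R d]_x (\1_ball x)%:E)%E by rewrite integral_indic ?setIT.
  rewrite (_ : (\sum_k _)%E = (\int[lebn R d]_x (\sum_k (\1_(cell k) x)%:E)))%E.
    apply: eq_integral => x _; rewrite sumEFin; congr EFin.
    rewrite (bigD1 (idx x))//= big1 => [|k kx].
      by rewrite addr0 !indicE /cell in_setI [X in _ && X]mem_set/= ?andbT.
    rewrite indicE /cell in_setI [X in _ && X]memNset ?andbF//=.
    by apply/negP; rewrite eq_sym.
  rewrite ge0_integral_sum//.
  - by apply: eq_bigr => k _; rewrite integral_indic ?setIT//; exact: measurable_cell.
  - by move=> k; apply/measurable_EFinP; apply: measurable_indic; exact: measurable_cell.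
rewrite (eq_bigr (fun k => (vol (cell k))%:E)) ?sumEFin// => k _.
by rewrite fineK// ge0_fin_numE//; exact: (okset_cell k).2.
Qed.

(** Since minors are at most 1, the expectation is at most the product of the [1 + a |c|], hence at
    most the exponential of the sum. *)
Lemma expectation_cprod_upper a : 0 <= a ->
  \int[P]_w cprod a w <= expR (a * vol ball).
Proof.
move=> a0; rewrite (expectation_cprod a).2.
apply: le_trans (ler_norm _) _.
apply: le_trans (psi_bound (okl_optional a _) (@smeas_rhos _ _ Sigma) (sbd_rhos Spos)) _.
rewrite mul1r /wt big_map -sum_vol_cells mulr_sumr expR_sum; apply: ler_prod => k _ /=.
rewrite normr1 (ger0_norm a0) expR_ge1Dx andbT.
by rewrite addr_ge0// mulr_ge0// vol_ge0.
Qed.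

End Cells.
End Process.

(** * The lower tail *)

Lemma expRN_lipschitz (R : realType) (a b : R) : 0 <= a -> expR (- a) <= expR (- b) + `|b - a|.
Proof.
move=> a0; have [ba|ab] := leP b a.
  by rewrite (@le_trans _ _ (expR (- b)))// ?lerDl// ler_expR lerN2.
have d0 : 0 < b - a by rewrite subr_gt0.
have -> : expR (- b) = expR (- a) * expR (- (b - a)) by rewrite -expRD; congr expR; lra.
have e1 : 1 - (b - a) <= expR (- (b - a)) by exact: expR_ge1Dx.
have e2 : expR (- a) <= 1 by rewrite -expR0 ler_expR oppr_le0.
have e3 := expR_ge0 (- a).
rewrite gtr0_norm//.
have : expR (- a) * (1 - (b - a)) <= expR (- a) * expR (- (b - a)) by rewrite ler_wpM2l.
have : expR (- a) * (b - a) <= 1 * (b - a) by rewrite ler_wpM2r// ltW.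
lra.
Qed.

Section Kernel.
Variables (R : realType) (d : nat) (Sigma : 'M[R]_d) (Spos : posdef Sigma).
Local Notation pt := (d.-tuple R).

Lemma normr_gaussK_le1 (x y : pt) : `|gaussK Sigma x y| <= 1.
Proof.
have [L HL] := gaussK_gram Spos.
rewrite ger0_norm ?gaussK_ge0// HL -expR0 ler_expR mulNr oppr_le0.
by rewrite mulr_ge0 ?divr_ge0// sumr_ge0// => k _; exact: sqr_ge0.
Qed.

Lemma gaussK_sym (x y : pt) : gaussK Sigma x y = gaussK Sigma y x.
Proof.
have [L HL] := gaussK_gram Spos; rewrite !HL; congr (expR (_ * _)); apply: eq_bigr => k _.
rewrite -sqrrN -sumrN; congr (_ ^+ 2); apply: eq_bigr => i _; ring.
Qed.

Lemma gaussK_lipschitz (r : R) : 0 <= r -> exists2 C : R, 0 <= C &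
  forall (delta : R) (x y z : pt), 0 <= delta -> cube r x -> cube r y -> cube r z ->
    (forall i, `|tnth x i - tnth y i| <= delta) ->
    gaussK Sigma x z <= gaussK Sigma y z + C * delta.
Proof.
move=> r0; have [L HL] := gaussK_gram Spos.
pose l k := \sum_i `|L k i|.
have l0 k : 0 <= l k by exact: sumr_ge0.
have Lbd k (v : 'I_d -> R) D : (forall i, `|v i| <= D) -> `|\sum_i L k i * v i| <= l k * D.
  move=> vD; rewrite (le_trans (ler_norm_sum _ _ _))// mulr_suml; apply: ler_sum => i _.
  by rewrite normrM ler_wpM2l.
(* Each difference of squares factors as [(w - u)(w + u)], with factors at most [l k * delta] and
   [l k * (4 r)] on the cube; the exponent carries a factor 1/2. *)
exists (2 * r * \sum_k l k ^+ 2).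
  by rewrite !mulr_ge0// sumr_ge0// => k _; exact: sqr_ge0.
move=> delta x y z d0 xr yr zr xy.
pose u k := \sum_i L k i * (tnth x i - tnth z i).
pose w k := \sum_i L k i * (tnth y i - tnth z i).
have -> : gaussK Sigma x z = expR (- (1 / 2 * \sum_k u k ^+ 2)) by rewrite HL mulNr.
have -> : gaussK Sigma y z = expR (- (1 / 2 * \sum_k w k ^+ 2)) by rewrite HL mulNr.
apply: le_trans (expRN_lipschitz (1 / 2 * \sum_k w k ^+ 2) _) _.
  by rewrite mulr_ge0 ?divr_ge0// sumr_ge0// => k _; exact: sqr_ge0.
rewrite lerD2l -mulrBr -sumrB normrM ger0_norm ?divr_ge0//.
suff H : `|\sum_k (w k ^+ 2 - u k ^+ 2)| <= \sum_k (l k * delta) * (l k * (4 * r)).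
  apply: (@le_trans _ _ (1 / 2 * \sum_k (l k * delta) * (l k * (4 * r)))).
    by rewrite ler_wpM2l// divr_ge0.
  rewrite -mulrA [X in _ <= X]mulrC !mulr_sumr le_eqVlt; apply/orP; left; apply/eqP.
  by apply: eq_bigr => k _; field.
apply: le_trans (ler_norm_sum _ _ _) _; apply: ler_sum => k _.
rewrite subr_sqr normrM; apply: ler_pM => //.
  rewrite /u /w -sumrB; under eq_bigr do rewrite -mulrBr.
  apply: Lbd => i; rewrite opprB addrA subrK distrC; exact: xy.
rewrite /u /w -big_split/=; under eq_bigr do rewrite -mulrDr.
apply: Lbd => i; rewrite addrACA.
have := xr i; have := yr i; have := zr i; rewrite !ler_norml => /andP[? ?] /andP[? ?] /andP[? ?].
by apply/andP; split; lra.
Qed.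

End Kernel.

Section LowerTail.
Variables (R : realType) (d : nat) (Sigma : 'M[R]_d) (Spos : posdef Sigma).
Hypothesis Snorm : (2 * pi) `^ (d%:R / 2) * Num.sqrt (\det Sigma) = 1.
Local Notation pt := (d.-tuple R).
Variables (r : R) (r0 : 0 <= r).
Local Notation ball := (@eball R d r).
Local Notation mu := (lebn R d).
Variables (K : finType) (idx : pt -> K).
Hypothesis midx : forall k, measurable [set x | idx x = k].
Local Notation cell := (cell r idx).

Lemma origin_ball : ball (origin R d).
Proof.
rewrite /eball/= big1 ?sqr_ge0// => i _; by rewrite tnth_mktuple expr0n.
Qed.

Lemma sum_cell_gaussK (z : pt) :
  \sum_k \int[mu]_(y in cell k) gaussK Sigma y z <= 1.
Proof.
have mK : measurable_fun [set: pt] (fun y => gaussK Sigma y z) by exact: measurable_gaussK.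
have K0 y : 0 <= gaussK Sigma y z by exact: gaussK_ge0.
have K1 y : `|gaussK Sigma y z| <= 1 by exact: normr_gaussK_le1.
rewrite -lee_fin -sumEFin.
rewrite (eq_bigr (fun k => (\int[mu]_y (gaussK Sigma y z * \1_(cell k) y)%R%:E)%E)); last first.
  move=> k _; have [mc fc] := @okset_cell R d r _ idx midx r0 k.
  rewrite /Rintegral fineK; last first.
    by apply: integrable_fin_num => //; exact: (bounded_integrable mc fc mK K1).
  rewrite [LHS]integral_mkcond; apply: eq_integral => x _.
  by rewrite patchE indicE; case: ifP; rewrite (mulr1, mulr0).
have mKc k : measurable_fun [set: pt] (fun y => (gaussK Sigma y z * \1_(cell k) y)%:E).
  apply/measurable_EFinP; apply: measurable_funM => //.
  by apply: measurable_indic; exact: measurable_cell.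
have Kc0 k (y : pt) : (0 <= (gaussK Sigma y z * \1_(cell k) y)%:E)%E.
  by rewrite lee_fin mulr_ge0.
rewrite -(ge0_integral_sum mu measurableT mKc (fun k y _ => Kc0 k y)).
have <- : lebint (fun y => (gaussK Sigma y z)%:E) = 1%E.
  by rewrite -(lebint_gaussK z Spos Snorm); apply: eq_lebint => y; rewrite gaussK_sym.
rewrite lebintE; last 2 first.
- exact/measurable_EFinP.
- by move=> y; rewrite lee_fin.
apply: ge0_le_integral => //.
- by move=> y _; apply: sume_ge0 => k _; exact: Kc0.
- exact: emeasurable_sum.
- exact/measurable_EFinP.
move=> y _; rewrite sumEFin lee_fin -mulr_sumr ler_piMr//.
rewrite (bigD1 (idx y))//= big1 => [|k kx].
  by rewrite addr0 indicE; case: (_ \in _).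
rewrite indicE memNset// => -[_ /eqP yk].
by rewrite yk eqxx in kx.
Qed.

Variables (eta s : R).
Hypotheses (eta0 : 0 <= eta) (s0 : 0 <= s) (seta : s * (1 + eta * vol ball) <= 1).
Hypothesis mesh : forall x y z, ball x -> ball y -> ball z -> idx x = idx y ->
  gaussK Sigma x z <= gaussK Sigma y z + eta.

Definition chosen (k : K) (x : pt) : Prop := vol (cell k) = 0 /\ x = origin R d \/ cell k x.

(** The left-hand side is a Riemann sum of [K(., z)] over the ball. Replacing the sample point of a
    cell by a variable one costs at most [eta] per unit volume, and the integral itself is at most
    1; null cells have weight 0. *)
Lemma sum_chosen_gaussK (f : K -> pt) (z : pt) : (forall k, chosen k (f k)) -> ball z ->
  \sum_k vol (cell k) * gaussK Sigma (f k) z <= 1 + eta * vol ball.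
Proof.
move=> fc bz.
have mK : measurable_fun [set: pt] (fun y => gaussK Sigma y z) by exact: measurable_gaussK.
have K0 y : 0 <= gaussK Sigma y z by exact: gaussK_ge0.
have K1 y : `|gaussK Sigma y z| <= 1 by exact: normr_gaussK_le1.
apply: (@le_trans _ _ (\sum_k (\int[mu]_(y in cell k) gaussK Sigma y z + eta * vol (cell k)))).
  apply: ler_sum => k _; have [mc fmc] := @okset_cell R d r _ idx midx r0 k.
  have [[-> _]|[bf fk]] := fc k.
    by rewrite mul0r mulr0 addr0; apply: Rintegral_ge0 => y _.
  have iK := bounded_integrable mc fmc mK K1.
  have ie : mu.-integrable (cell k) (EFin \o cst eta).
    by apply: (@bounded_integrable _ _ _ mu _ mc fmc _ `|eta|).
  rewrite /vol -(Rintegral_cst mu mc eta) -RintegralD// mulrC -(Rintegral_cst mu mc).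
  apply: le_Rintegral => //.
  - by apply: (@bounded_integrable _ _ _ mu _ mc fmc _ 1) => // y; exact: K1.
  - by have := integrableD mc iK ie.
  - move=> y [by_ yk]; apply: mesh => //.
    by move: fk yk => /eqP -> /eqP ->.
rewrite big_split/= -mulr_sumr (sum_vol_cells midx r0) lerD2r.
exact: sum_cell_gaussK.
Qed.

Lemma adm_chosen (ks : seq K) (k0 : K) (a : R) (xs : seq pt) :
  adm [seq (a, cell k) | k <- ks] xs ->
  size xs = size ks /\
  forall i, (i < size ks)%N -> chosen (nth k0 ks i) (nth (origin R d) xs i).
Proof.
elim: ks xs => [|k ks IH] [|x xs]//= [kx /IH[-> H]]; split => // -[|i]//; exact: H.
Qed.

Lemma psi_lower : psi (optional r idx (- s) (index_enum K)) (rhos Sigma) <= expR (- (s * vol ball)).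
Proof.
set ks := index_enum K; pose k0 := idx (origin R d).
have -> : optional r idx (- s) ks = [seq (1, e.1, e.2) | e <- [seq (- s, cell k) | k <- ks]].
  by rewrite -map_comp.
apply: (psi_average (M := 1)).
- by rewrite -map_comp; exact: (okl_optional midx r0 (- s) ks).
- exact: smeas_rhos.
- exact: sbd_rhos.
move=> xs /(adm_chosen k0)[sxs xsc].
rewrite (_ : rhos Sigma = detK (gaussK Sigma) (origin R d))//.
rewrite subsum_detK.
set m := size _; set M := \matrix_(i, j) _.
have mE : m = size ks by rewrite /m size_zip !size_map sxs minnn.
pose v i := vol (cell (nth k0 ks i)); pose x i := nth (origin R d) xs i.
have wE i : (i < m)%N -> nth (0, origin R d) (wlist [seq (- s, cell k) | k <- ks] xs) i =
    (- s * v i, x i).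
  rewrite mE => im; rewrite nth_zip; last by rewrite !size_map sxs.
  by rewrite -map_comp (nth_map k0).
have ME i j : M i j = (i == j)%:R - s * v i * gaussK Sigma (x i) (x j).
  by rewrite mxE !wE//= !mulNr.
have bx i : (i < m)%N -> ball (x i).
  by rewrite mE => /xsc; rewrite -/(x i) => -[[_ ->]|[]//]; exact: origin_ball.
pose f k := x (index k ks).
have fc k : chosen k (f k).
  have kks : k \in ks by rewrite mem_index_enum.
  by have := xsc (index k ks); rewrite nth_index// index_mem; exact.
have colsum z : ball z -> \sum_(j < m) v j * gaussK Sigma (x j) z <= 1 + eta * vol ball.
  move=> bz; apply: le_trans (sum_chosen_gaussK fc bz); rewrite le_eqVlt; apply/orP; left.
  rewrite (big_nth k0) big_mkord -mE; apply/eqP; apply: eq_bigr => j _.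
  by rewrite /f index_uniq// ?index_enum_uniq// -mE.
(* The cell volumes weight the rows of [M], so the Riemann sums control its column sums; the
   M-matrix bound is therefore applied to the transpose. *)
have Moff i j : i != j -> M^T i j <= 0.
  move=> ij; rewrite mxE ME eq_sym (negPf ij) sub0r oppr_le0.
  by rewrite !mulr_ge0// ?vol_ge0// gaussK_ge0.
have Mrow i : 0 <= \sum_j M^T i j.
  under eq_bigr do rewrite mxE ME; rewrite sumrB.
  rewrite (_ : \sum_(j < m) (j == i)%:R = 1); last first.
    by rewrite (bigD1 i)//= eqxx big1 ?addr0// => j /negPf ->.
  rewrite subr_ge0; under eq_bigr do rewrite -mulrA; rewrite -mulr_sumr.
  by apply: le_trans seta; apply: ler_wpM2l => //; apply: colsum; exact/bx/ltn_ord.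
have /andP[_ detle] := det_Mmatrix_bounds Moff Mrow.
rewrite -det_tr; apply: le_trans detle _.
have -> : \prod_(i < m) M^T i i = \prod_k (1 - s * vol (cell k)).
  rewrite [RHS](big_nth k0) big_mkord -mE; apply: eq_bigr => i _.
  by rewrite mxE ME eqxx gaussKxx mulr1.
have -> : - (s * vol ball) = \sum_k - (s * vol (cell k)).
  by rewrite sumrN -mulr_sumr (sum_vol_cells midx r0).
(* Comparing the products factor by factor requires [s |c_k| <= 1]. This holds because [|c_k|] is
   the k-th term of the Riemann sum centred at [f k], where the kernel is 1. *)
rewrite expR_sum; apply: ler_prod => k _; rewrite expR_ge1Dx andbT subr_ge0.
apply: le_trans seta; rewrite ler_wpM2l//.
have bfk : ball (f k) by case: (fc k) => [[_ ->]|[]//]; exact: origin_ball.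
apply: le_trans (sum_chosen_gaussK fc bfk).
rewrite (bigD1 k)//= gaussKxx mulr1 lerDl sumr_ge0// => j _.
by rewrite mulr_ge0 ?vol_ge0// gaussK_ge0.
Qed.

End LowerTail.

(** * Exponential bounds and grids *)

Section ExponentialBounds.
Variable R : realType.

Lemma expR_ge_quadratic (t : R) : 0 <= t -> 1 + t + t ^+ 2 / 2 <= expR t.
Proof.
move=> t0; apply: limr_ge; first exact: is_cvg_series_exp_coeff.
near=> N; have N3 : (3 <= N)%N by near: N; exact: nbhs_infty_ge.
rewrite -(subnK N3) addn3 /series/= !big_nat_recl//= addrA addrA.
rewrite /exp_coeff/= expr0 expr1 !fact0 divr1 (_ : 1`! = 1%N)// divr1 (_ : 2`! = 2%N)// lerDl.
by apply: sumr_ge0 => i _; rewrite divr_ge0// exprn_ge0.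
Unshelve. all: by end_near. Qed.

(** The product of [1 - t + t^2/2] and [1 + t + t^2/2] is [1 + t^4/4], so the lower bound on
    [expR t] inverts. *)
Lemma expRN_le_quadratic (t : R) : 0 <= t -> expR (- t) <= 1 - t + t ^+ 2 / 2.
Proof.
move=> t0; rewrite expRN -div1r ler_pdivrMr ?expR_gt0//.
have q : 0 < 1 - t + t ^+ 2 / 2 by have := sqr_ge0 (t - 1); rewrite sqrrB expr1n mulr1; lra.
apply: le_trans (ler_wpM2l (ltW q) (expR_ge_quadratic t0)).
have -> : (1 - t + t ^+ 2 / 2) * (1 + t + t ^+ 2 / 2) = 1 + (t ^+ 2 / 2) ^+ 2 by field.
by rewrite lerDl sqr_ge0.
Qed.

Lemma fact_ge_geom k : (2 * 3 ^ k <= k.+2`!)%N.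
Proof.
elim: k => [//|k IH]; rewrite factS expnS mulnCA; apply: leq_mul => //.
Qed.

(* The exponential series is dominated from its quadratic term on by the
   geometric series of ratio t / 3. *)
Lemma expR_le_bernstein (t : R) : 0 <= t -> t < 3 ->
  expR t <= 1 + t + t ^+ 2 / (2 * (1 - t / 3)).
Proof.
move=> t0 t3; have q1 : t / 3 < 1 by rewrite ltr_pdivrMr// mul1r.
have q0 : 0 <= t / 3 by rewrite divr_ge0.
apply: limr_le; first exact: is_cvg_series_exp_coeff.
near=> N; have N2 : (2 <= N)%N by near: N; exact: nbhs_infty_ge.
rewrite -(subnK N2) addn2; move: (N - 2)%N => m; rewrite /series/= !big_nat_recl//= addrA.
rewrite /exp_coeff/= expr0 expr1 !fact0 divr1 (_ : 1`! = 1%N)// divr1 lerD2l.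
apply: (@le_trans _ _ (t ^+ 2 / 2 * \sum_(0 <= i < m) (t / 3) ^+ i)).
  rewrite mulr_sumr; apply: ler_sum => i _.
  rewrite expr_div_n mulf_div -exprD add2n ler_wpM2l ?exprn_ge0//.
  have f1 : (0 : R) < (i.+2)`!%:R by rewrite ltr0n fact_gt0.
  have f2 : (0 : R) < 2 * 3 ^+ i by rewrite mulr_gt0// exprn_gt0.
  rewrite (lef_pV2 f1 f2).
  by rewrite -natrX -natrM ler_nat fact_ge_geom.
rewrite invfM mulrA ler_wpM2l ?divr_ge0 ?exprn_ge0//.
have : (1 - t / 3) * \sum_(0 <= i < m) (t / 3) ^+ i <= 1.
  rewrite big_mkord -[1 - _]opprB mulNr -subrX1 opprB gerBl exprn_ge0//.
by rewrite -[X in _ -> _ <= X]div1r ler_pdivlMr ?subr_gt0// mulrC.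
Unshelve. all: by end_near. Qed.

End ExponentialBounds.

(** * A finite measurable partition of small mesh *)

Section Grid.
Variables (R : realType) (d : nat) (r : R).
Hypothesis r0 : 0 <= r.
Local Notation pt := (d.-tuple R).

Definition gridI (delta : R) : finType := ('I_d * 'I_((Num.truncn (2 * r / delta)).+1))%type.

Definition gridK (delta : R) : finType := {ffun gridI delta -> bool}.

Definition threshold (delta : R) (p : gridI delta) : R := - r + delta * (nat_of_ord p.2)%:R.

(** A point is labelled by the outcomes of all threshold comparisons. This is total on [R^d] with
    finitely many values and measurable fibres; the price is that inconsistent labels have empty
    cells. *)
Definition grid (delta : R) (x : pt) : gridK delta :=
  [ffun p : gridI delta => threshold p <= tnth x p.1].

Lemma measurable_grid delta (k : gridK delta) : measurable [set x | grid delta x = k].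
Proof.
have -> : [set x | grid delta x = k] = \bigcap_(p in [set: gridI delta])
    ((@tnth d R ^~ p.1) @^-1` [set t | (threshold p <= t) = k p]).
  apply/seteqP; split=> x /=; first by move=> <- p _ /=; rewrite ffunE.
  by move=> H; apply/ffunP => p; rewrite ffunE; exact: H.
apply: fin_bigcap_measurable => // p _; rewrite -[X in measurable X]setTI.
apply: measurable_tnth => //; case: (k p).
  rewrite (_ : [set t | _] = `[(threshold p), +oo[%classic)//.
  by apply/seteqP; split => t /=; rewrite in_itv/= andbT.
rewrite (_ : [set t | _] = `]-oo, (threshold p)[%classic)//.
by apply/seteqP; split => t /=; rewrite in_itv/= ltNge; [move=> ->|move/negbTE].
Qed.

(** If the gap exceeded [delta], the first threshold above [tnth x i] would lie strictly below
    [tnth y i], and the labels would differ. It belongs to the grid because [tnth y i <= r]. *)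
Lemma grid_mesh1 delta (x y : pt) i : 0 < delta -> cube r x -> cube r y ->
  grid delta x = grid delta y -> tnth y i - tnth x i <= delta.
Proof.
move=> d0 xr yr xy; rewrite leNgt; apply/negP => lt_xy.
have := xr i; have := yr i; rewrite !ler_norml => /andP[y1 y2] /andP[x1 x2].
pose t := (tnth x i + r) / delta.
have t0 : 0 <= t by rewrite divr_ge0 ?(ltW d0)//; lra.
have /andP[tl tr] := truncn_itv t0.
pose j := (Num.truncn t).+1.
have thx : tnth x i < - r + delta * j%:R.
  by move: tr; rewrite ltr_pdivrMr// -/j mulrC; lra.
have thy : - r + delta * j%:R < tnth y i.
  apply: le_lt_trans (_ : tnth x i + delta < _); last by lra.
  by move: tl; rewrite /j -natr1 mulrDr mulr1 ler_pdivlMr// mulrC; lra.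
have jJ : (j < (Num.truncn (2 * r / delta)).+1)%N.
  rewrite ltnS -(ler_nat R); apply: contraT; rewrite -ltNge => H.
  have /andP[_] : (Num.truncn (2 * r / delta))%:R <= 2 * r / delta < (Num.truncn (2 * r / delta)).+1%:R.
    by apply: truncn_itv; rewrite divr_ge0 ?(ltW d0)// mulr_ge0.
  move: H; rewrite ltr_nat => H1; rewrite ltNge => /negP H2; exfalso; apply: H2.
  apply: (@le_trans _ _ j%:R); first by rewrite ler_nat.
  by rewrite ler_pdivlMr// mulrC; lra.
have := congr1 (fun f : gridK delta => f (i, Ordinal jJ)) xy.
by rewrite !ffunE/= /threshold/= (ltW thy) leNgt thx.
Qed.

Lemma grid_mesh delta (x y : pt) : 0 < delta -> cube r x -> cube r y ->
  grid delta x = grid delta y -> forall i, `|tnth x i - tnth y i| <= delta.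
Proof.
move=> d0 xr yr xy i; rewrite ler_norml lerNl opprB.
by rewrite !grid_mesh1.
Qed.

Lemma near_all_seq (T : eqType) (s : seq T) (Q : nat -> T -> Prop) :
  (forall x, x \in s -> \forall n \near \oo, Q n x) ->
  \forall n \near \oo, forall x, x \in s -> Q n x.
Proof.
elim: s => [|x s IH] H; first exact: nearW.
have H1 := H x (mem_head _ _).
have H2 := IH (fun y ys => H y (mem_behead (s := x :: s) ys)).
near=> n => y; rewrite inE => /orP[/eqP ->|ys]; first by near: n.
by move: y ys; near: n.
Unshelve. all: by end_near. Qed.

Lemma near_grid_inj (s : seq pt) : (forall x, x \in s -> cube r x) ->
  \forall n \near \oo, {in s &, injective (grid n.+1%:R^-1)}.
Proof.
move=> sr.
have H x y : x \in s -> y \in s -> \forall n \near \oo,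
    grid n.+1%:R^-1 x = grid n.+1%:R^-1 y -> x = y.
  move=> xs ys; have [->|xy] := eqVneq x y; first exact: nearW.
  have [i xyi] : exists i, tnth x i != tnth y i.
    apply/existsP; apply: contraNT xy => /existsPn H.
    by apply/eqP/eq_from_tnth => i; apply/eqP; have := H i; rewrite negbK.
  have e0 : 0 < `|tnth x i - tnth y i| by rewrite normr_gt0 subr_eq0.
  near=> n => gxy; exfalso.
  have := grid_mesh _ (sr x xs) (sr y ys) gxy i.
  rewrite invr_gt0 ltr0n => /(_ isT); rewrite leNgt => /negP; apply.
  by near: n; exact: (near_infty_natSinv_lt (PosNum e0)).
have H2 : \forall n \near \oo, forall x, x \in s -> forall y, y \in s ->
    grid n.+1%:R^-1 x = grid n.+1%:R^-1 y -> x = y.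
  apply: near_all_seq => x xs; apply: near_all_seq => y ys; exact: H.
near=> n; move=> x y xs ys; move: x xs y ys; near: n; exact: H2.
Unshelve. all: by end_near. Qed.

End Grid.

(** * Concentration *)

Lemma limn_einf_le (R : realType) (u : (\bar R)^nat) (C : \bar R) :
  (forall n, (u n <= C)%E) -> (limn_einf u <= C)%E.
Proof.
move=> uC; rewrite limn_einf_lim; apply: lime_le; first exact: is_cvg_einfs.
apply: nearW => n; apply: le_trans (uC n); apply: ereal_inf_lbound.
by exists n => /=.
Qed.

Section Concentration.
Variables (R : realType) (d : nat) (Sigma : 'M[R]_d) (Spos : posdef Sigma).
Hypothesis Snorm : (2 * pi) `^ (d%:R / 2) * Num.sqrt (\det Sigma) = 1.
Context (dO : measure_display) (Omega : measurableType dO) (P : probability Omega R).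
Variables (X : Omega -> set (d.-tuple R)) (hX : gaussian_dpp P Sigma X).
Variables (r : R) (r0 : 0 <= r).
Local Notation pt := (d.-tuple R).
Local Notation ball := (@eball R d r).
Local Notation V := (vol ball).
Local Notation Z := (npts X ball).

Lemma expectation_ball : (\int[P]_w npoints (X w) ball)%E = lebvol ball.
Proof.
have := hX.2 1%N (fun=> ball) isT (fun _ _ => @measurable_eball R d r).
have dis : forall i j, (i < 1)%N -> (j < 1)%N -> i <> j -> ball `&` ball = set0 by case=> [|i] [|j].
move=> /(_ dis) H.
transitivity (\int[P]_w (\prod_(i < 1) npoints (X w) ball))%E.
  by apply: eq_integral => w _; rewrite big_ord_recl big_ord0 mule1.
rewrite H /=; apply: eq_lebint => x.
by rewrite big_ord_recl big_ord0 mule1 /= /rho det_mx11 mxE /= gaussKxx// mule1.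
Qed.

Definition gprod (n : nat) (a : R) (w : Omega) : R := cprod X r (grid r n.+1%:R^-1) a w.

Lemma npts_ball w : Z w = (size (pts X r w))%:R.
Proof. by rewrite /npts (npoints_ball hX). Qed.

Lemma gprodE n a w : gprod n a w =
  \prod_k (1 + a * (count (fun x => grid r n.+1%:R^-1 x == k) (pts X r w))%:R).
Proof. by apply: eq_bigr => k _; rewrite (npts_cell hX). Qed.

Lemma pts_cube w x : x \in (pts X r w : seq pt) -> cube r x.
Proof.
rewrite /pts => xw; have fw := finite_ball hX r w.
have : x \in fset_set (X w `&` ball) by [].
by rewrite in_fset_set// inE => -[_ /eball_sub_cube]; apply.
Qed.

Lemma gprod_near a w : \forall n \near \oo, gprod n a w = (1 + a) ^+ size (pts X r w).
Proof.
have H := near_grid_inj r0 (@pts_cube w).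
near=> n; rewrite gprodE; apply: prod_count_inj; first exact: fset_uniq.
near: n; exact: H.
Unshelve. all: by end_near. Qed.

Lemma gprod_bound n a w : `|gprod n a w| <= (1 + `|a|) ^+ size (pts X r w).
Proof. by rewrite gprodE; exact: prod_count_bound. Qed.

Lemma expR_pts (t : R) w : expR (t * Z w) = (1 + (expR t - 1)) ^+ size (pts X r w).
Proof. by rewrite npts_ball expRM_natr addrC subrK. Qed.

Lemma measurable_gprod n a : measurable_fun [set: Omega] (gprod n a).
Proof.
apply: measurable_prodr => k; apply: measurable_funD => //; apply: measurable_funM => //.
apply: (measurable_npts hX); apply: measurable_cell; exact: measurable_grid.
Qed.

Lemma measurable_expR_pts t : measurable_fun [set: Omega] (fun w => expR (t * Z w)).
Proof.
apply: measurableT_comp => //; apply: measurable_funM => //.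
by apply: (measurable_npts hX); exact: measurable_eball.
Qed.

Lemma integral_gprod n a : (\int[P]_w (gprod n a w)%:E)%E = (\int[P]_w gprod n a w)%:E.
Proof.
rewrite /Rintegral fineK//; apply: integrable_fin_num => //.
exact: (expectation_cprod Spos hX (@measurable_grid R d r n.+1%:R^-1) r0 a).1.
Qed.

Lemma gprod_cvg t w :
  (gprod n (expR t - 1) w)%:E @[n --> \oo] --> (expR (t * Z w))%:E.
Proof.
apply: cvg_near_cst; have H := gprod_near (expR t - 1) w.
by near=> n; rewrite expR_pts; congr EFin; near: n.
Unshelve. all: by end_near. Qed.

Lemma laplace_upper (t : R) : 0 <= t ->
  (\int[P]_w (expR (t * Z w))%:E <= (expR ((expR t - 1) * V))%:E)%E.
Proof.
move=> t0; have a0 : 0 <= expR t - 1 by rewrite subr_ge0 -expR0 ler_expR.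
have f0 n w : (0 <= (gprod n (expR t - 1) w)%:E)%E.
  by rewrite lee_fin gprodE; apply: prodr_ge0 => k _; rewrite addr_ge0// mulr_ge0.
have mf n : measurable_fun [set: Omega] (fun w => (gprod n (expR t - 1) w)%:E).
  exact/measurable_EFinP/measurable_gprod.
(* For each outcome the products are eventually constant, equal to [expR (t * Z w)], since
   [1 + a = expR t]. Writing this value as a lower limit prepares Fatou's lemma. *)
have -> : (\int[P]_w (expR (t * Z w))%:E)%E =
    (\int[P]_w limn_einf (fun n => (gprod n (expR t - 1) w)%:E))%E.
  by apply: eq_integral => w _; rewrite (cvg_limn_einf_sup (@gprod_cvg t w)).1.
apply: le_trans (fatou P measurableT mf (fun n w _ => f0 n w)) _.
apply: limn_einf_le => n; rewrite integral_gprod lee_fin.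
exact: (expectation_cprod_upper Spos hX (@measurable_grid R d r n.+1%:R^-1) r0 a0).
Qed.

Lemma integrable_expR_pts (t : R) : 0 <= t ->
  P.-integrable [set: Omega] (EFin \o (fun w => expR (t * Z w))).
Proof.
move=> t0; apply/integrableP; split; first exact/measurable_EFinP/measurable_expR_pts.
under eq_integral => w _ do rewrite /= ger0_norm ?expR_ge0//.
by apply: le_lt_trans (laplace_upper t0) _; rewrite ltry.
Qed.

Lemma laplace_lower (t : R) : 0 <= t ->
  (\int[P]_w (expR (- t * Z w))%:E <= (expR (- ((1 - expR (- t)) * V)))%:E)%E.
Proof.
move=> t0; set s := 1 - expR (- t).
have s0 : 0 <= s by rewrite subr_ge0 -expR0 ler_expR oppr_le0.
have s1 : s < 1 by rewrite gtrBl expR_gt0.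
have aE : expR (- t) - 1 = - s by rewrite opprB.
(* [expR (u * Z w)] is [(1 + s)^N], the bound of [gprod_bound], and [laplace_upper] at [u] makes it
   integrable. *)
pose u := ln (1 + s).
have u0 : 0 <= u by rewrite ln_ge0// lerDl.
have ue : expR u = 1 + s by rewrite lnK// posrE ltr_wpDr.
have mf n : measurable_fun [set: Omega] (fun w => (gprod n (- s) w)%:E).
  exact/measurable_EFinP/measurable_gprod.
have mlim : measurable_fun [set: Omega] (fun w => (expR (- t * Z w))%:E).
  exact/measurable_EFinP/measurable_expR_pts.
have cv : {ae P, forall w, [set: Omega] w ->
    (gprod n (- s) w)%:E @[n --> \oo] --> (expR (- t * Z w))%:E}.
  by apply/aeW => w _; rewrite -aE; exact: gprod_cvg.
have dom : {ae P, forall w n, [set: Omega] w ->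
    (`|(gprod n (- s) w)%:E| <= (EFin \o (fun w => expR (u * Z w))) w)%E}.
  apply/aeW => w n _; rewrite /= lee_fin expR_pts ue (le_trans (gprod_bound _ _ _))//.
  by rewrite normrN (ger0_norm s0) addrAC subrr add0r.
have [_ _ lim] := dominated_convergence measurableT mf mlim cv (integrable_expR_pts u0) dom.
rewrite -(cvg_lim _ lim)//; apply: lime_le; first by apply/cvg_ex; eexists; exact: lim.
have [C C0 CL] := gaussK_lipschitz Spos r0.
have V0 : 0 <= V by exact: vol_ge0.
(* With [eta = C q], where q is the mesh, [q (C V + 1) < 1 - s] yields
   [s (1 + eta V) <= s + C q V <= 1]; the added 1 keeps the denominator positive. *)
have e0 : 0 < (1 - s) / (C * V + 1) by rewrite divr_gt0 ?subr_gt0// ltr_wpDl// mulr_ge0.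
near=> n; rewrite /= integral_gprod lee_fin.
have n0 : 0 < n.+1%:R^-1 :> R by rewrite invr_gt0.
rewrite (expectation_cprod Spos hX (@measurable_grid R d r n.+1%:R^-1) r0 (- s)).2.
apply: (psi_lower Spos Snorm r0 (@measurable_grid R d r n.+1%:R^-1) (eta := C * n.+1%:R^-1)) => //.
  have nlt : n.+1%:R^-1 < (1 - s) / (C * V + 1).
    by near: n; exact: (near_infty_natSinv_lt (PosNum e0)).
  have CV : 0 <= C * V by rewrite mulr_ge0.
  have CV1 : 0 < C * V + 1 by rewrite ltr_wpDl.
  move: nlt; rewrite (ltr_pdivlMr _ _ CV1) => nlt.
  have H1 : s * (C * n.+1%:R^-1 * V) <= 1 * (C * n.+1%:R^-1 * V).
    by apply: ler_wpM2r; [rewrite mulr_ge0// mulr_ge0// ltW|exact: ltW].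
  move: n0 nlt H1; move: (n.+1%:R^-1) => q q0 nlt H1.
  rewrite mulrDr mulr1; apply: le_trans (lerD (lexx s) H1) _; rewrite mul1r.
  have -> : C * q * V = q * (C * V + 1) - q by ring.
  lra.
move=> x y z /(eball_sub_cube r0) bx /(eball_sub_cube r0) by_ /(eball_sub_cube r0) bz xy.
by apply: (CL _ x y z (ltW n0)) => //; exact: (grid_mesh r0 n0).
Unshelve. all: by end_near. Qed.

Lemma chernoff (Y : Omega -> R) : measurable_fun [set: Omega] Y ->
  (P [set w | (0 <= Y w)%R] <= \int[P]_w (expR (Y w))%:E)%E.
Proof.
move=> mY; have mA : measurable [set w | 0 <= Y w].
  rewrite (_ : [set w | _] = Y @^-1` `[0, +oo[).
    by rewrite -[X in measurable X]setTI; exact: mY.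
  by apply/seteqP; split=> w /=; rewrite in_itv/= andbT.
rewrite -[X in P X]setIT -integral_indic//; apply: ge0_le_integral => //.
- exact/measurable_EFinP/measurable_indic.
- by apply/measurable_EFinP; exact: measurableT_comp.
move=> w _; rewrite lee_fin indicE; case: (boolP (w \in _)) => [|_]; last exact: expR_ge0.
by rewrite inE/= => Y0; rewrite -expR0 ler_expR.
Qed.

Lemma measurable_Z : measurable_fun [set: Omega] Z.
Proof. by apply: (measurable_npts hX); exact: measurable_eball. Qed.

Lemma chernoff_laplace (t c B : R) :
  (\int[P]_w (expR (t * Z w))%:E <= (expR B)%:E)%E ->
  (P [set w | (0 <= t * Z w - c)%R] <= (expR (B - c))%:E)%E.
Proof.
move=> HB; apply: le_trans (chernoff _) _.
  apply: measurable_funB => //; apply: measurable_funM => //; exact: measurable_Z.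
under eq_integral => w _ do rewrite expRD EFinM.
rewrite ge0_integralZr//.
- rewrite expRD EFinM lee_pmul//.
  by apply: integral_ge0 => w _; rewrite lee_fin expR_ge0.
- exact/measurable_EFinP/measurable_expR_pts.
Qed.

Lemma measurable_deviation (eps c : R) : measurable [set w | eps <= `| Z w / c - 1 |].
Proof.
rewrite (_ : [set w | _] = (fun w => `| Z w / c - 1 |) @^-1` `[eps, +oo[).
  rewrite -[X in measurable X]setTI.
  have : measurable_fun [set: Omega] (fun w => `| Z w / c - 1 |).
    apply: measurableT_comp => //; apply: measurable_funB => //.
    by apply: measurable_funM => //; exact: measurable_Z.
  by apply.
by apply/seteqP; split=> w /=; rewrite in_itv/= andbT.
Qed.

Lemma concentration (eps : R) : 0 < eps -> 0 < V ->
  (P [set w | (eps <= `| Z w / V - 1 |)%R] <=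
    (2 * expR (- (3 * eps ^+ 2 / (6 + 2 * eps)) * V))%:E)%E.
Proof.
move=> e0 V0; pose t := 3 * eps / (3 + eps).
(* Bernstein's choice [t = eps / (1 + eps / 3)] gives [1 - t / 3 = 3 / (3 + eps)], whence
   [t * eps - t^2 / (2 (1 - t / 3))] is exactly the rate D below. *)
have e3 : 0 < 3 + eps by rewrite addr_gt0.
have t0 : 0 <= t by rewrite divr_ge0 ?mulr_ge0// ltW.
have t3 : t < 3 by rewrite ltr_pdivrMr//; lra.
set D := 3 * eps ^+ 2 / (6 + 2 * eps).
have up : (P [set w | (0 <= t * Z w - t * (1 + eps) * V)%R] <= (expR (- D * V))%:E)%E.
  apply: le_trans (chernoff_laplace _ (laplace_upper t0)) _.
  rewrite lee_fin ler_expR -mulrBl; apply: ler_wpM2r; first exact: ltW.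
  have := expR_le_bernstein t0 t3.
  have -> : 1 + t + t ^+ 2 / (2 * (1 - t / 3)) = 1 + t * (1 + eps) - D.
    have e3n : 3 + eps != 0 by rewrite gt_eqF.
    have e6n : 6 + 2 * eps != 0 by rewrite gt_eqF// addr_gt0// mulr_gt0.
    have -> : 1 - t / 3 = 3 / (3 + eps) by rewrite /t; field.
    by rewrite /t /D; field; rewrite e6n e3n.
  by lra.
(* Below the mean, the parameter [eps] itself gives rate at least [eps^2 / 2], by the quadratic
   bound on [expR (- eps)]; this dominates D. *)
have lo : (P [set w | (0 <= - eps * Z w - (- eps * (1 - eps) * V))%R] <= (expR (- D * V))%:E)%E.
  apply: le_trans (chernoff_laplace _ (laplace_lower (ltW e0))) _.
  rewrite lee_fin ler_expR -mulNr -mulrBl; apply: ler_wpM2r; first exact: ltW.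
  have := expRN_le_quadratic (ltW e0).
  have : D <= eps ^+ 2 / 2.
    rewrite /D ler_pdivrMr ?addr_gt0 ?mulr_gt0//.
    have := exprn_gt0 3 e0.
    have -> : eps ^+ 2 / 2 * (6 + 2 * eps) = 3 * eps ^+ 2 + eps ^+ 3 by field.
    lra.
  lra.
have mS (c c' : R) : measurable [set w | 0 <= c * Z w - c'].
  rewrite (_ : [set w | _] = (fun w => c * Z w - c') @^-1` `[0, +oo[).
    rewrite -[X in measurable X]setTI.
    have : measurable_fun [set: Omega] (fun w => c * Z w - c').
      by apply: measurable_funB => //; apply: measurable_funM => //; exact: measurable_Z.
    by apply.
  by apply/seteqP; split=> w /=; rewrite in_itv/= andbT.
have mT := measurable_deviation eps V.
apply: (@le_trans _ _ (P ([set w | (0 <= t * Z w - t * (1 + eps) * V)%R] `|`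
                          [set w | (0 <= - eps * Z w - (- eps * (1 - eps) * V))%R]))).
  apply: le_measure; rewrite ?inE//; first exact: measurableU.
  move=> w /=; have tp : 0 < t by rewrite divr_gt0 ?mulr_gt0.
  rewrite ler_normr => /orP[H|H]; [left|right].
    by move: H; rewrite lerBrDr ler_pdivlMr// -mulrA -mulrBr => H; rewrite mulr_ge0// subr_ge0 addrC.
  have : Z w / V <= 1 - eps by lra.
  rewrite ler_pdivrMr// => H1; rewrite !mulNr -mulrA.
  have := ler_wpM2l (ltW e0) H1; lra.
apply: le_trans (measureU2 _ (mS _ _) (mS _ _)) _.
by rewrite mulr_natl mulr2n EFinD leeD.
Qed.

End Concentration.

Theorem theorem2 (R : realType) (d : nat) (hd : (0 < d)%N)
  (Sigma : 'M[R]_d) (hSigma : posdef Sigma)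
  (hnorm : (2 * pi) `^ (d%:R / 2) * Num.sqrt (\det Sigma) = 1)
  (dO : measure_display) (Omega : measurableType dO) (P : probability Omega R)
  (X : Omega -> set (d.-tuple R)) (hX : gaussian_dpp P Sigma X)
  (r : R) (hr : 0 < r) :
  let N := fun w => npoints (X w) (eball r) in
  let n := (\int[P]_w N w)%E in
  n = lebvol (eball (d:=d) r) /\
  lebvol (eball (d:=d) r) = (lebvol (eball (d:=d) 1) * (r ^+ d)%:E)%E /\
  (forall eps : R, (0 < eps)%R ->
    P [set w | (eps <= `| fine (N w) / fine n - 1 |)%R] <=
    ((2 * expR (- (3 * eps ^+ 2 / (6 + 2 * eps)) * fine (lebvol (eball (d:=d) r))))%R)%:E)%E.
Proof.
move=> N n; have nE : n = lebvol (eball (d:=d) r) by exact: (expectation_ball hX r).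
split => //; split; first exact: lebvol_eball.
move=> eps eps0; rewrite nE lebvolE; last exact: measurable_eball.
(* At volume 0 the right-hand side is 2, which bounds any probability; otherwise the volume is
   positive and division by it is meaningful. *)
rewrite -/(vol _); have [V0|] := eqVneq (vol (@eball R d r)) 0.
  rewrite V0 mulr0 expR0 mulr1.
  apply: le_trans (probability_le1 P (measurable_deviation hX r eps 0)) _.
  by rewrite lee_fin ler1n.
move=> Vn; apply: (concentration hSigma hnorm hX (ltW hr) eps0).
by rewrite lt_def Vn vol_ge0.
Qed.
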